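(* Let $T$ and $T'$ be two measure-preserving ergodic transformations of a standard probability space $(X,\mu)$. Then the following are equivalent: (1) $T$ and $T'$ are flip-conjugate; (2) the groups $[T]_1$ and $[T']_1$ are abstractly isomorphic (isomorphic as groups); (3) the groups $[T]_1$ and $[T']_1$ are topologically isomorphic (isomorphic as topological groups).
   Context: A standard probability space $(X,\mu)$ is a standard Borel space with a non-atomic Borel probability measure. $\mathrm{Aut}(X,\mu)$ is the group of measure-preserving Borel bijections of $X$, identified when they agree almost everywhere; everything is considered up to null sets. $T\in\mathrm{Aut}(X,\mu)$ is ergodic if every Borel set which is a union of $T$-orbits has measure $0$ or $1$; it is aperiodic if (almost) all its orbits are infinite (ergodic transformations are aperiodic since $\mu$ is non-atomic). For aperiodic $T$, the full group is $[T]=\{U\in\mathrm{Aut}(X,\mu): U(x)\in\{T^n(x):n\in\mathbb Z\}\text{ for a.e. }x\}$, and each $U\in[T]$ has a cocycle $c_U:X\to\mathbb Z$ defined by $U(x)=T^{c_U(x)}(x)$. The $\mathrm L^1$ full group is $[T]_1=\{U\in[T]:\int_X|c_U|\,d\mu<+\infty\}$, with the topology induced by the metric $\tilde d_T(U,V)=\int_X|c_U(x)-c_V(x)|\,d\mu(x)$. Two measure-preserving transformations $T,T'$ are flip-conjugate if there is $S\in\mathrm{Aut}(X,\mu)$ such that $T'=STS^{-1}$ or $T'=ST^{-1}S^{-1}$. *)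

(* Defs.v *)
From HB Require Import structures.
From mathcomp Require Import all_boot all_order all_algebra.
From mathcomp Require Import all_classical all_reals all_analysis.
From mathcomp Require Import generic_quotient.

Set Implicit Arguments.
Unset Strict Implicit.
Unset Printing Implicit Defensive.

Import Order.TTheory GRing.Theory Num.Theory.

Local Open Scope classical_set_scope.
Local Open Scope ring_scope.

(* The sigma-algebra of X is the Borel sigma-algebra of a separable complete
   metric, carried over to X by a bijection f with a metric space P. *)
Definition standard_borel (R : realType) d (X : measurableType d) : Prop :=
  exists (P : metricType R) (f : X -> P),
    [/\ (exists2 D : set P, countable D & dense D),
        (forall F : set_system P, ProperFilter F -> cauchy F ->
          exists l : P, F --> l),
        bijective f
      & forall A : set X, measurable A <-> <<s @open P >> (f @` A)].

Definition nonatomic (R : realType) d (X : measurableType d)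
    (mu : {measure set X -> \bar R}) : Prop :=
  ~ exists A : set X, [/\ measurable A, (0 < mu A)%E
      & forall B : set X, measurable B -> B `<=` A -> mu B = 0%E \/ mu B = mu A].

Definition standard_probability_space (R : realType) d (X : measurableType d)
    (mu : probability X R) : Prop :=
  standard_borel R X /\ nonatomic mu.

(* On a standard Borel space the inverse of a Borel bijection is Borel
   (Lusin-Souslin); it is recorded here, so that no hypothesis on X is needed
   to form the group of these maps. *)
Record mp_bij (R : realType) d (X : measurableType d) (mu : probability X R) :=
  MpBij {
    mp_fun :> X -> X;
    mp_inv : X -> X;
    mp_funK : cancel mp_fun mp_inv;
    mp_invK : cancel mp_inv mp_fun;
    measurable_mp_fun : measurable_fun setT mp_fun;
    measurable_mp_inv : measurable_fun setT mp_inv;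
    mp_funP : forall A, measurable A -> pushforward mu mp_fun A = mu A
  }.

Section aut.
Context (R : realType) d (X : measurableType d) (mu : probability X R).
Implicit Types f g h : mp_bij mu.

HB.instance Definition _ := gen_eqMixin (mp_bij mu).
HB.instance Definition _ := gen_choiceMixin (mp_bij mu).

Definition mp_one : mp_bij mu.
Proof. by exists id id => //; exact: measurable_id. Defined.

Lemma mp_mul_subproof f g A : measurable A -> pushforward mu (f \o g) A = mu A.
Proof.
move=> mA; rewrite -(mp_funP f mA) /pushforward comp_preimage.
have mfA : measurable (f @^-1` A).
  by rewrite -[X in measurable X]setTI; exact: (measurable_mp_fun f).
exact: (mp_funP g mfA).
Qed.

Definition mp_mul f g : mp_bij mu :=
  MpBij (can_comp (mp_funK f) (mp_funK g)) (can_comp (mp_invK g) (mp_invK f))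
    (measurableT_comp (measurable_mp_fun f) (measurable_mp_fun g))
    (measurableT_comp (measurable_mp_inv g) (measurable_mp_inv f))
    (@mp_mul_subproof f g).

Lemma mp_opp_subproof f A : measurable A -> pushforward mu (mp_inv f) A = mu A.
Proof.
move=> mA; have mfA : measurable (mp_inv f @^-1` A).
  by rewrite -[X in measurable X]setTI; exact: (measurable_mp_inv f).
rewrite /pushforward -(mp_funP f mfA) /pushforward -comp_preimage.
by congr (mu _); apply/seteqP; split => x /=; rewrite mp_funK.
Qed.

Definition mp_opp f : mp_bij mu :=
  MpBij (mp_invK f) (mp_funK f) (measurable_mp_inv f) (measurable_mp_fun f)
    (@mp_opp_subproof f).

Lemma ae_mp_comp f (P : X -> Prop) :
  {ae mu, forall x, P x} -> {ae mu, forall x, P (f x)}.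
Proof.
move=> [N [mN N0 PN]]; exists (f @^-1` N); split.
- by rewrite -[X in measurable X]setTI; exact: (measurable_mp_fun f).
- by rewrite -N0; exact: (mp_funP f mN).
- by move=> x /= Px; exact: PN.
Qed.

Definition ae_eq_mp f g : bool := `[< {ae mu, forall x, f x = g x} >].

Lemma ae_eq_mp_refl : reflexive ae_eq_mp.
Proof. by move=> f; apply/asboolP; exact: aeW. Qed.

Lemma ae_eq_mp_sym : symmetric ae_eq_mp.
Proof.
by move=> f g; apply/asboolP/asboolP; apply: filterS => x ->.
Qed.

Lemma ae_eq_mp_trans : transitive ae_eq_mp.
Proof.
move=> g f h /asboolP fg /asboolP gh; apply/asboolP.
by apply: filterS2 fg gh => x -> ->.
Qed.

Canonical ae_eq_mp_equiv :=
  EquivRel ae_eq_mp ae_eq_mp_refl ae_eq_mp_sym ae_eq_mp_trans.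

Local Open Scope quotient_scope.

Definition aut : Type := {eq_quot ae_eq_mp}.
HB.instance Definition _ := Choice.on aut.
HB.instance Definition _ := EqQuotient.on aut.

Lemma autP f g :
  reflect {ae mu, forall x, f x = g x} (f == g %[mod aut]).
Proof. by apply: (iffP idP); rewrite eqmodE // => /asboolP. Qed.

Lemma aut_reprE f : {ae mu, forall x, repr (\pi_aut f) x = f x}.
Proof. by apply/autP; rewrite reprK. Qed.

Definition aut_one : aut := \pi_aut mp_one.
Definition aut_mul (U V : aut) : aut := \pi_aut (mp_mul (repr U) (repr V)).
Definition aut_inv (U : aut) : aut := \pi_aut (mp_opp (repr U)).

Lemma aut_mulE f g : aut_mul (\pi_aut f) (\pi_aut g) = \pi_aut (mp_mul f g).
Proof.
apply/eqP/autP; apply: filterS2 (aut_reprE g) (ae_mp_comp g (aut_reprE f)).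
by move=> x /= -> ->.
Qed.

Lemma aut_invE f : aut_inv (\pi_aut f) = \pi_aut (mp_opp f).
Proof.
apply/eqP/autP; apply: filterS (ae_mp_comp (mp_opp f) (aut_reprE f)) => x /=.
by rewrite mp_invK => {1}<-; rewrite mp_funK.
Qed.

Lemma aut_mulA : associative aut_mul.
Proof.
elim/quotW => f; elim/quotW => g; elim/quotW => h; rewrite (aut_mulE g h) (aut_mulE f g).
rewrite (aut_mulE f (mp_mul g h)) (aut_mulE (mp_mul f g) h).
by apply/eqP/autP; exact: aeW.
Qed.

Lemma aut_mul1 : left_id aut_one aut_mul.
Proof.
by elim/quotW => f; rewrite aut_mulE; apply/eqP/autP; exact: aeW.
Qed.

Lemma aut_mulr1 : right_id aut_one aut_mul.
Proof.
by elim/quotW => f; rewrite aut_mulE; apply/eqP/autP; exact: aeW.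
Qed.

Lemma aut_mulV : left_inverse aut_one aut_inv aut_mul.
Proof.
elim/quotW => f; rewrite aut_invE aut_mulE; apply/eqP/autP.
by apply: aeW => x /=; rewrite mp_funK.
Qed.

Lemma aut_mulrV : right_inverse aut_one aut_inv aut_mul.
Proof.
elim/quotW => f; rewrite aut_invE aut_mulE; apply/eqP/autP.
by apply: aeW => x /=; rewrite mp_invK.
Qed.

(* The product U * V is the class of the composition x |-> U (V x). *)
HB.instance Definition _ :=
  isGroup.Build aut aut_mulA aut_mul1 aut_mulr1 aut_mulV aut_mulrV.

(* A chosen representative. The notions below do not depend on this choice;
   for the cocycle, up to a null set, and for aperiodic T. *)
Definition aut_repr (U : aut) : mp_bij mu := repr U.

End aut.

Coercion aut_repr : aut >-> mp_bij.

Section full_group.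
Context (R : realType) d (X : measurableType d) (mu : probability X R).
Implicit Types S T U V : aut mu.

Definition aut_iter T (n : int) (x : X) : X :=
  match n with
  | Posz k => iter k T x
  | Negz k => iter k.+1 (mp_inv T) x
  end.

Definition ergodic T : Prop :=
  forall A : set X, measurable A ->
    (forall x (n : int), A x -> A (aut_iter T n x)) ->
    mu A = 0%E \/ mu A = 1%E.

Definition flip_conjugate T T' : Prop :=
  exists S, (T' = S * T * S^-1)%g \/ (T' = S * T^-1 * S^-1)%g.

Definition full_group T : set (aut mu) :=
  [set U | {ae mu, forall x, exists n : int, U x = aut_iter T n x}].

(* For aperiodic T and U in the full group of T, almost every x has a unique n
   with U x = T^n x; the value is 0 where there is no such n, or several. *)
Definition cocycle T U (x : X) : int :=
  xget 0 [set n | forall m : int, U x = aut_iter T m x <-> m = n].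

Definition L1_full_group T : set (aut mu) :=
  [set U | full_group T U /\
    (\int[mu]_x (`|(cocycle T U x)%:~R : R|)%:E < +oo)%E].

Definition L1_dist T U V : \bar R :=
  \int[mu]_x (`|(cocycle T U x - cocycle T V x)%:~R : R|)%:E.

End full_group.

(* A and B are meant to be subgroups, with the laws of G and H. *)
Definition group_isomorphism (G H : groupType) (A : set G) (B : set H)
    (phi : G -> H) : Prop :=
  set_bij A B phi /\
  forall x y, A x -> A y -> phi (x * y)%g = (phi x * phi y)%g.

Definition metric_continuous (R : realType) (G H : Type) (A : set G)
    (dG : G -> G -> \bar R) (dH : H -> H -> \bar R) (phi : G -> H) : Prop :=
  forall x, A x -> forall e : R, 0 < e -> exists2 r : R, 0 < r &
    forall y, A y -> (dG x y < r%:E)%E -> (dH (phi x) (phi y) < e%:E)%E.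

Section L1_isomorphism.
Context (R : realType) d (X : measurableType d) (mu : probability X R).
Implicit Types T : aut mu.

Definition L1_isomorphic T T' : Prop :=
  exists phi : aut mu -> aut mu,
    group_isomorphism (L1_full_group T) (L1_full_group T') phi.

Definition L1_topologically_isomorphic T T' : Prop :=
  exists phi psi : aut mu -> aut mu,
    [/\ group_isomorphism (L1_full_group T) (L1_full_group T') phi,
        group_isomorphism (L1_full_group T') (L1_full_group T) psi,
        (forall U, L1_full_group T U -> psi (phi U) = U),
        metric_continuous (L1_full_group T) (L1_dist T) (L1_dist T') phi
      & metric_continuous (L1_full_group T') (L1_dist T') (L1_dist T) psi].

End L1_isomorphism.

(* Main.v *)
Require Import Defs.
From HB Require Import structures.
From mathcomp Require Import all_boot all_order all_algebra.
From mathcomp Require Import all_classical all_reals all_analysis.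
From mathcomp Require Import measurable_realfun generic_quotient zify lra.

Set Implicit Arguments.
Unset Strict Implicit.
Unset Printing Implicit Defensive.

Import Order.TTheory GRing.Theory Num.Theory.
Import numFieldNormedType.Exports.

Local Open Scope classical_set_scope.
Local Open Scope ring_scope.

(** A conjugacy [T' = S T S^-1] or [T' = S T^-1 S^-1] turns cocycles into cocycles up
    to sign and composition with [S], so conjugation by [S] is an isometric
    isomorphism between the integrable full groups. The substance is the converse:
    an abstract isomorphism [phi] from [[T]_1] onto [[T']_1] comes from a flip
    conjugacy. There are two steps.

    Reconstruction (Dye, Fremlin). By Poincare recurrence, [[T]_1] contains
    involutions with bounded cocycles whose supports exhaust any given measurable
    set, and it is closed under cutting an element to an invariant set. In such a
    group, the subgroup of the elements supported in the support of an involution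
    [p] is definable from [p] by commutation ([support_subgroupE]), and an element
    is supported in the complement of a set as soon as it commutes with everything
    supported in that set. Hence [phi] induces a sigma-complete isomorphism of the
    measure algebra ([support_match_realized]). In a standard Borel space such an
    isomorphism is induced by a point map: for almost every [x], it prescribes which
    closed balls of a countable family contain the value at [x], and completeness
    provides the point ([point_realization]). The map so obtained implements [phi]
    by conjugation, and the image of [mu] under it is [T]-invariant and absolutely
    continuous, hence equal to [mu] by ergodicity: the orbit of a positive set of
    the Hahn decomposition of the difference is null or conull
    ([ergodic_invariant_measure]). So [phi] is the conjugation by an automorphism
    [S] ([reconstruction]).

    Belinskaya's theorem. Now [U = S T S^-1] belongs to [[T']_1] and has the orbits of
    [T']. Identify a [T']-orbit with the integers; the points of a [U]-orbit then
    give a bijection of the integers. Integrability of the cocycle and the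
    Borel-Cantelli lemma show that it crosses the origin finitely many times, so
    it sends the two ends to the two ends ([end_to_end]). By ergodicity the
    direction is constant, and it is positive after possibly replacing [U] by its
    inverse. The forward orbits of a point under [U] and under [T'] then differ by
    finitely many points, and sending [x] to the point of its orbit for which this
    difference is balanced conjugates [U] to [T'] ([interleaved_conjugate]). *)

(** * Null sets *)

Section almost_everywhere.
Context (R : realType) d (X : measurableType d) (mu : probability X R).
Implicit Types (P Q : X -> Prop) (A B : set X) (f g : mp_bij mu).

Lemma ae_forall_int (P : int -> X -> Prop) :
  (forall n, {ae mu, forall x, P n x}) -> {ae mu, forall x, forall n, P n x}.
Proof.
move=> aeP.
have aeP0 : {ae mu, forall x, forall n : nat, P (Posz n) x}.
  exact: (@ae_foralln _ _ _ mu (fun n => P (Posz n))).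
have aeP1 : {ae mu, forall x, forall n : nat, P (Negz n) x}.
  exact: (@ae_foralln _ _ _ mu (fun n => P (Negz n))).
by apply: filterS2 aeP0 aeP1 => x P0 P1 [] n.
Qed.

Lemma ae_measure0 A : measurable A ->
  {ae mu, forall x, ~ A x} <-> mu A = 0%E.
Proof.
move=> mA; split.
  case=> N [mN N0 AN]; apply/eqP; rewrite eq_le measure_ge0 andbT -N0.
  by rewrite le_measure ?inE// => x Ax; apply: AN => /= /(_ Ax).
by move=> A0; exists A; split => // x /= /contrapT.
Qed.

Lemma measure_eq_ae A B : measurable A -> measurable B ->
  {ae mu, forall x, A x <-> B x} -> mu A = mu B.
Proof.
move=> mA mB AB.
have subm C D : measurable C -> measurable D ->
    {ae mu, forall x, C x -> D x} -> (mu C <= mu D)%E.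
  move=> mC mD CD; have CD0 : mu (C `\` D) = 0%E.
    apply/ae_measure0; first exact: measurableD.
    by apply: filterS CD => x CDx [Cx]; apply; apply: CDx.
  have -> : mu C = (mu (C `\` D) + mu (C `&` D))%E by exact: measureDI.
  rewrite CD0 add0e.
  by rewrite le_measure ?inE//; exact: measurableI.
apply/eqP; rewrite eq_le !subm//.
  by apply: filterS AB => x [].
by apply: filterS AB => x [].
Qed.

Lemma mp_preimage_measurable f A : measurable A -> measurable (f @^-1` A).
Proof.
by move=> mA; rewrite -[X in measurable X]setTI; exact: (measurable_mp_fun f).
Qed.

Lemma mp_preimageE f A : measurable A -> mu (f @^-1` A) = mu A.
Proof. exact: mp_funP. Qed.

Lemma measurable_preimage (g : X -> X) A : measurable_fun setT g ->
  measurable A -> measurable (g @^-1` A).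
Proof. by move=> mg mA; rewrite -[X in measurable X]setTI; exact: mg. Qed.

Lemma ae_forall_count (I : countType) (P : I -> X -> Prop) :
  (forall i, {ae mu, forall x, P i x}) -> {ae mu, forall x, forall i, P i x}.
Proof.
move=> aeP.
have : {ae mu, forall x, forall n : nat,
    if unpickle n is Some i then P i x else True}.
  apply: ae_foralln => n; case: (unpickle n) => [i|]; [exact: aeP|exact: aeW].
by apply: filterS => x Px i; have := Px (pickle i); rewrite pickleK.
Qed.

End almost_everywhere.

(** * Iterates *)

Section iterates.
Context (R : realType) d (X : measurableType d) (mu : probability X R).
Implicit Types (t u : mp_bij mu) (n m : int).

Definition mp_pow t n : mp_bij mu :=
  match n with
  | Posz k => iter k (mp_mul t) (mp_one mu)
  | Negz k => iter k.+1 (mp_mul (mp_opp t)) (mp_one mu)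
  end.

Lemma mp_pow_iter t k x : mp_pow t (Posz k) x = iter k t x.
Proof. by elim: k => //= k <-. Qed.

Lemma aut_iterE (T : aut mu) n x : aut_iter T n x = mp_pow T n x.
Proof.
case: n => k; first by rewrite mp_pow_iter.
rewrite /aut_iter/mp_pow; elim: k => //= k IH; congr (mp_inv _ _).
exact: IH.
Qed.

Lemma mp_pow0 t x : mp_pow t 0 x = x. Proof. by []. Qed.

Lemma mp_pow1 t x : mp_pow t 1 x = t x. Proof. by []. Qed.

Lemma mp_powS t n x : mp_pow t (n + 1) x = t (mp_pow t n x).
Proof.
case: n => k; first by rewrite addrC -intS.
have -> : Negz k + 1 = - k%:Z by lia.
by case: k => [|k] /=; rewrite mp_invK.
Qed.

Lemma mp_powB1 t n x : mp_pow t (n - 1) x = mp_inv t (mp_pow t n x).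
Proof. by rewrite -{2}[n](subrK 1) mp_powS mp_funK. Qed.

Lemma mp_powD t n m x : mp_pow t (m + n) x = mp_pow t m (mp_pow t n x).
Proof.
elim: m => [|m IH|m IH]; first by rewrite add0r.
  have -> : m.+1%:Z + n = (m%:Z + n) + 1 by lia.
  by rewrite mp_powS IH -mp_powS; congr (mp_pow _ _ _); lia.
have -> : - m.+1%:Z + n = (- m%:Z + n) - 1 by lia.
by rewrite mp_powB1 IH -mp_powB1; congr (mp_pow _ _ _); lia.
Qed.

Lemma mp_powK t n x : mp_pow t (- n) (mp_pow t n x) = x.
Proof. by rewrite -mp_powD addNr. Qed.

Lemma mp_powNK t n x : mp_pow t n (mp_pow t (- n) x) = x.
Proof. by rewrite -mp_powD addrN. Qed.

Lemma mp_powV t n x : mp_pow (mp_opp t) n x = mp_pow t (- n) x.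
Proof.
elim: n => [|n _|n IH] //.
have -> : - n.+1%:Z = - n%:Z - 1 by lia.
by rewrite mp_powB1 IH opprB addrC mp_powS opprK.
Qed.

Lemma ae_orbit t (P : X -> Prop) : {ae mu, forall x, P x} ->
  {ae mu, forall x, forall n, P (mp_pow t n x)}.
Proof. by move=> aeP; apply: ae_forall_int => n; exact: ae_mp_comp. Qed.

(** Almost everywhere equality of the generators passes to all iterates,
    since almost every orbit avoids the exceptional null set. *)
Lemma ae_mp_pow t u : {ae mu, forall x, t x = u x} ->
  {ae mu, forall x, forall n, mp_pow t n x = mp_pow u n x}.
Proof.
move=> /(ae_orbit u); apply: filterS => x tu; elim => [|n IH|n IH] //.
  by rewrite intS addrC !mp_powS IH.
have -> : - n.+1%:Z = - n%:Z - 1 by lia.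
rewrite !mp_powB1 IH.
apply: (can_inj (mp_funK t)); rewrite mp_invK.
by have := tu (- n%:Z - 1); rewrite mp_powB1 mp_invK => ->.
Qed.

Lemma ae_mp_pow_conj (f : mp_bij mu) t u :
  {ae mu, forall x, f (t x) = u (f x)} ->
  {ae mu, forall x, forall n, f (mp_pow t n x) = mp_pow u n (f x)}.
Proof.
move=> /(ae_orbit t); apply: filterS => x tu; elim => [|n IH|n IH] //.
  by rewrite intS addrC !mp_powS tu IH.
have -> : - n.+1%:Z = - n%:Z - 1 by lia.
rewrite !mp_powB1 -IH.
apply: (can_inj (mp_funK u)); rewrite mp_invK.
by have := tu (- n%:Z - 1); rewrite mp_powB1 mp_invK => ->.
Qed.

End iterates.

Global Opaque mp_pow.

(** * Almost everywhere calculus in the automorphism group *)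

Section aut_calculus.
Context (R : realType) d (X : measurableType d) (mu : probability X R).
Implicit Types (U V W : aut mu) (f : mp_bij mu).

Definition aut_of f : aut mu := \pi_(aut mu)%qT f.

Lemma aut_ofE f : {ae mu, forall x, aut_of f x = f x}.
Proof. exact: aut_reprE. Qed.

Lemma aut_eqP U V : U = V <-> {ae mu, forall x, U x = V x}.
Proof.
split=> [->|UV]; first exact: aeW.
by rewrite -[U]reprK -[V]reprK; apply/eqP/autP.
Qed.

Lemma aut_mul_ae U V : {ae mu, forall x, aut_repr (U * V)%g x = U (V x)}.
Proof. exact: aut_reprE. Qed.

Lemma aut_one_ae : {ae mu, forall x, aut_repr (1%g : aut mu) x = x}.
Proof. exact: aut_reprE. Qed.

Lemma aut_inv_ae U : {ae mu, forall x, aut_repr (U^-1)%g x = mp_inv U x}.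
Proof. exact: aut_reprE. Qed.

End aut_calculus.

(** * Standard Borel spaces *)

(** The part of the structure of a Polish space that is used below: for each
    [n], a countable cover by (preimages of) closed balls of radius [1/(n+1)].
    Completeness is [scheme_fip], a compactness principle along branches. *)
Record ball_scheme d (X : measurableType d) (Q : nat -> nat -> set X) : Prop :=
  BallScheme {
    scheme_measurable : forall n k, measurable (Q n k);
    scheme_cover : forall n x, exists k, Q n k x;
    scheme_fip : forall k : nat -> nat,
      (forall N, exists x, forall n, (n < N)%N -> Q n (k n) x) ->
      exists x, forall n, Q n (k n) x;
    scheme_uniq : forall (k : nat -> nat) N x y,
      (forall n, (N <= n)%N -> Q n (k n) x) ->
      (forall n, (N <= n)%N -> Q n (k n) y) -> x = y;
    scheme_separate : forall m j x, ~ Q m j x ->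
      exists n k, Q n k x /\ forall y, Q n k y -> ~ Q m j y;
    scheme_generate : forall A, measurable A ->
      <<s [set B | exists n k, B = Q n k] >> A
  }.

Section standard_borel_scheme.
Context (R : realType).

Let rad (n : nat) : R := n.+1%:R^-1.

Let rad_gt0 n : 0 < rad n. Proof. by rewrite invr_gt0 ltr0n. Qed.

Let rad_lt (e : R) : 0 < e -> exists N, forall n, (N <= n)%N -> 2 * rad n < e.
Proof.
move=> e0; exists (Num.truncn (2 / e)) => n Nn.
rewrite /rad ltr_pdivrMr ?ltr0n// mulrC -ltr_pdivrMr//.
apply: lt_le_trans (truncnS_gt _) _.
by rewrite ler_nat ltnS.
Qed.

Let rad_le m n : (m <= n)%N -> rad n <= rad m.
Proof. by move=> mn; rewrite lef_pV2 ?posrE ?ltr0n// ler_nat ltnS. Qed.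

Lemma standard_borel_scheme d (X : measurableType d) :
  standard_borel R X -> exists Q : nat -> nat -> set X, ball_scheme Q.
Proof.
case=> P [f [[D /countable_injP[code] codeI denseD] complete [g fK gK] mX]].
pose cball n (p : P) := [set q | mdist p q <= rad n].
pose Q n k := [set x : X | exists p, [/\ D p, code p = k & cball n p (f x)]].
have QE n p : D p -> Q n (code p) = f @^-1` cball n p.
  move=> Dp; apply/seteqP; split => [x [q [Dq /codeI qp]]|x px].
    by rewrite qp ?inE.
  by exists p.
have near2 n p x y : cball n p x -> cball n p y -> mdist x y <= 2 * rad n.
  move=> px py; apply: le_trans (metric_triangle _ p _) _.
  by rewrite mulrDl !mul1r lerD// metric_sym.
have ocball n p : open (~` cball n p).
  rewrite openE => x /= /negP; rewrite -ltNge => px.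
  apply/nbhs_ballP; exists (mdist p x - rad n); first by rewrite /= subr_gt0.
  move=> y; rewrite ballEmdist /= => xy /=; apply/negP; rewrite -ltNge.
  have := metric_triangle p y x; rewrite (metric_sym y x); lra.
have cover n x : exists2 p, D p & cball n p (f x).
  have [] := denseD (ball (f x) (rad n))^°.
  - by exists (f x); rewrite /interior; apply/nbhs_ballP; exists (rad n) => /=.
  - exact: open_interior.
  move=> p [/interior_subset xp Dp]; exists p => //; move: xp; rewrite ballEmdist /= => xp.
  by rewrite /cball /= metric_sym ltW.
have Qcode n k x : Q n k x -> exists2 p, D p & k = code p.
  by case=> p [Dp <- _]; exists p.
exists Q; split.
- move=> n k; have [[p [Dp <-]]|nk] := pselect (exists p, D p /\ code p = k).
    rewrite QE//; apply/mX; rewrite image_preimage; last first.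
      by rewrite -subTset => q _; exists (g q); rewrite ?gK.
    rewrite -[cball n p]setCK -setTD; apply: sigma_algebraCD.
    by apply: sub_sigma_algebra; exact: ocball.
  rewrite (_ : Q n k = set0) //; apply/seteqP; split => // x [p [Dp pk _]].
  by apply: nk; exists p.
- by move=> n x; have [p Dp px] := cover n x; exists (code p); exists p.
- move=> k /choice[x Qx].
  have xk n N : (n < N)%N -> Q n (k n) (x N) by exact: Qx.
  have kc n : exists2 p, D p & k n = code p by exact: Qcode (xk n n.+1 (ltnSn n)).
  have {}kc n : {p | D p & k n = code p} by apply: cid2.
  pose p n := s2val (kc n).
  have Dp n : D (p n) by rewrite /p; case: (kc n).
  have pk n : k n = code (p n) by rewrite /p; case: (kc n).
  have px n N : (n < N)%N -> cball n (p n) (f (x N)).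
    by move=> /xk; rewrite pk QE.
  have cF : cauchy (f (x N) @[N --> \oo]).
    apply/cauchy_ballP => e /rad_lt[M Me].
    pose A := [set q | exists2 N, (M < N)%N & q = f (x N)].
    exists (A, A); first by split; exists M.+1 => // N MN; exists N.
    move=> [_ _] [[N MN ->] [N' MN' ->]] /=; rewrite ballEmdist /=.
    by apply: le_lt_trans (Me M (leqnn M)); apply: near2 (px _ _ _) (px _ _ _).
  have [l fl] := complete _ _ cF.
  exists (g l) => n; rewrite pk QE//= gK.
  apply: contrapT => nl.
  have /fl : nbhs l (~` cball n (p n)) by exact: open_nbhs_nbhs.
  case=> N _ /(_ (maxn N n.+1)) /=; rewrite leq_maxl => /(_ isT); apply.
  by apply: px; rewrite leq_maxr.
- move=> k N x y xQ yQ; apply: (can_inj fK); apply: contrapT => /eqP.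
  rewrite -mdist_gt0 => /rad_lt[M Mxy].
  pose n := maxn N M.
  have [p Dp kp] : exists2 p, D p & k n = code p.
    by apply: Qcode (xQ n _); rewrite leq_maxl.
  have := xQ n (leq_maxl _ _); have := yQ n (leq_maxl _ _).
  rewrite kp QE// => yp xp.
  have := near2 _ _ _ _ xp yp; rewrite leNgt => /negP; apply.
  by apply: Mxy; rewrite leq_maxr.
- move=> m j x nQ.
  have [[q [Dq qj]]|nj] := pselect (exists q, D q /\ code q = j); last first.
    have [p Dp px] := cover 0 x; exists 0, (code p); split; first by exists p.
    by move=> y _ [q [Dq qj _]]; apply: nj; exists q.
  move: nQ; rewrite -qj QE// => /= /negP; rewrite -ltNge -subr_gt0.
  move=> /rad_lt[n /(_ n (leqnn n)) nlt].
  have [p Dp px] := cover n x; exists n, (code p); split; first by exists p.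
  move=> y; rewrite QE// => py /=; apply/negP; rewrite -ltNge.
  have := near2 _ _ _ _ px py; have := metric_triangle q (f y) (f x).
  rewrite (metric_sym (f y)); lra.
- move=> A /mX sA.
  suff : [set B : set P | <<s [set B | exists n k, B = Q n k] >> (f @^-1` B)] (f @` A).
    rewrite /= (_ : f @^-1` _ = A)//; apply/seteqP; split => [x [y Ay /(can_inj fK) <-]//|x Ax].
    by exists x.
  apply: smallest_sub sA.
    split => /=.
    + by rewrite preimage_set0; exact: sigma_algebra0.
    + by move=> B sB; rewrite setTD preimage_setC -setTD; exact: sigma_algebraCD.
    + by move=> B sB; rewrite preimage_bigcup; exact: sigma_algebra_bigcup.
  move=> U oU /=.
  pose J (i : nat * nat) := Q i.1 i.2 `<=` f @^-1` U.
  pose F i := if unpickle i is Some j then (if `[< J j >] then Q j.1 j.2 else set0) else set0.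
  have -> : f @^-1` U = \bigcup_i F i.
    apply/seteqP; split => [x /= Ux|x [i _]].
      have : nbhs (f x) U by exact: open_nbhs_nbhs.
      move=> /nbhs_ballP[e /= /rad_lt[n /(_ n (leqnn n)) ne] eU].
      have [p Dp px] := cover n x; exists (pickle (n, code p)) => //.
      rewrite /F pickleK asboolT; first by exists p.
      move=> y /=; rewrite QE// => py; apply: eU; rewrite ballEmdist /=.
      by apply: le_lt_trans ne; exact: near2 px py.
    rewrite /F; case: unpickle => [[n k]|[]].
    by case: asboolP => [Jnk /Jnk|_ []].
  apply: sigma_algebra_bigcup => i; rewrite /F; case: unpickle => [[n k]|]; last exact: sigma_algebra0.
  case: asboolP => _; last exact: sigma_algebra0.
  by apply: sub_sigma_algebra; exists n, k.
Qed.

End standard_borel_scheme.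

Section point_realization.
Context (R : realType) d (X : measurableType d) (mu : probability X R).
Variables (Q : nat -> nat -> set X) (QS : ball_scheme Q).

Lemma scheme_neq x y : x <> y -> exists n k, Q n k x /\ ~ Q n k y.
Proof.
move=> xy; have /choice[k kx] := scheme_cover QS ^~ x.
apply: contrapT => nQ; apply: xy; apply: (scheme_uniq QS (k := k) (N := 0)) => n _ //.
by apply: contrapT => ny; apply: nQ; exists n, (k n).
Qed.

(** Equality is a countable Boolean combination of measurable conditions. *)
Lemma measurable_eq_fun (f g : X -> X) :
  measurable_fun setT f -> measurable_fun setT g ->
  measurable [set x | f x = g x].
Proof.
move=> mf mg.
have -> : [set x | f x = g x] =
    ~` \bigcup_n \bigcup_k (f @^-1` Q n k `&` ~` (g @^-1` Q n k)).
  apply/seteqP; split => [x /= fg [n _ [k _ [/= + ]]]|x /= nQ]; first by rewrite fg.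
  apply: contrapT => /scheme_neq[n [k fgQ]]; apply: nQ.
  by exists n => //; exists k.
apply: measurableC; apply: bigcup_measurable => n _.
apply: bigcup_measurable => k _; have mQ := scheme_measurable QS n k.
by apply: measurableI; [|apply: measurableC]; exact: measurable_preimage.
Qed.

Lemma ae_eq_fun (f g : X -> X) :
  (forall A, measurable A -> {ae mu, forall x, A (f x) <-> A (g x)}) ->
  {ae mu, forall x, f x = g x}.
Proof.
move=> fg.
have : {ae mu, forall x, forall i : nat * nat,
    Q i.1 i.2 (f x) <-> Q i.1 i.2 (g x)}.
  by apply: ae_forall_count => i; apply: fg; exact: scheme_measurable QS _ _.
apply: filterS => x fgx; apply: contrapT => /scheme_neq[n [k [fQ]]]; apply.
exact: (fgx (n, k)).1.
Qed.

Variable Phi : set X -> set X.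
Hypothesis mPhi : forall A, measurable A -> measurable (Phi A).
Hypothesis PhiC : forall A, measurable A ->
  {ae mu, forall x, Phi (~` A) x <-> ~ Phi A x}.
Hypothesis PhiU : forall F : nat -> set X, (forall n, measurable (F n)) ->
  {ae mu, forall x, Phi (\bigcup_n F n) x <-> exists n, Phi (F n) x}.

Lemma Phi_setT : {ae mu, forall x, Phi setT x}.
Proof.
pose F n : set X := if n is 0%N then setT else set0.
have mF n : measurable (F n) by case: n => /=.
have FT : \bigcup_n F n = setT by rewrite -subTset => x _; exists 0%N.
apply: filterS2 (PhiC measurableT) (PhiU mF) => x C.
rewrite FT => -[_ FU].
apply: contrapT => nT; apply: (nT); apply: FU; exists 1%N => /=.
by rewrite -setCT; exact: C.2.
Qed.

Lemma Phi_set0 : {ae mu, forall x, ~ Phi set0 x}.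
Proof.
by rewrite -setCT; apply: filterS2 Phi_setT (PhiC measurableT) => x ? [C _] /C.
Qed.

Lemma Phi_fip (s : seq nat) :
  {ae mu, forall x, (forall n, (n < size s)%N -> Phi (Q n (nth 0%N s n)) x) ->
    exists y, forall n, (n < size s)%N -> Q n (nth 0%N s n) y}.
Proof.
have [[y sy]|nsy] := pselect (exists y, forall n, (n < size s)%N -> Q n (nth 0%N s n) y).
  by apply: aeW => x _; exists y.
pose F n := if (n < size s)%N then ~` Q n (nth 0%N s n) else set0.
have mQ := scheme_measurable QS.
have mF n : measurable (F n) by rewrite /F; case: ifP => // _; exact: measurableC.
have FT : \bigcup_n F n = setT.
  rewrite -subTset => x _; apply: contrapT => nF; apply: nsy; exists x => n ns.
  by apply: contrapT => nQ; apply: nF; exists n; rewrite // /F ns.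
have aeQ : {ae mu, forall x, forall n,
    Phi (~` Q n (nth 0%N s n)) x <-> ~ Phi (Q n (nth 0%N s n)) x}.
  by apply: ae_foralln => n; exact: PhiC.
apply: filterS3 (PhiU mF) Phi_setT (filterI Phi_set0 aeQ) => x.
rewrite FT => -[FU _] /FU[n Fn] [n0 QC] sx.
exfalso; move: Fn; rewrite /F; case: ifPn => // ns /QC; apply.
exact: sx.
Qed.

Lemma Phi_separate (i : nat * nat) :
  {ae mu, forall x, ~ Phi (Q i.1 i.2) x -> exists n k,
    Phi (Q n k) x /\ forall y, Q n k y -> ~ Q i.1 i.2 y}.
Proof.
have mQ := scheme_measurable QS.
pose J (j : nat * nat) := forall y, Q j.1 j.2 y -> ~ Q i.1 i.2 y.
pose F l := if unpickle l is Some j then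
  (if `[< J j >] then Q j.1 j.2 else set0) else set0.
have mF l : measurable (F l).
  by rewrite /F; case: unpickle => // j; case: ifP.
have FE : \bigcup_l F l = ~` Q i.1 i.2.
  apply/seteqP; split => [x [l _]|x /(scheme_separate QS)[n [k [nkx nkJ]]]].
    rewrite /F; case: unpickle => [j|[]]; by case: asboolP => [Jj /Jj|_ []].
  by exists (pickle (n, k)) => //; rewrite /F pickleK asboolT.
apply: filterS3 Phi_set0 (PhiU mF) (PhiC (mQ i.1 i.2)) => x n0.
rewrite FE => -[FU _] [_ QC] /QC/FU[l].
rewrite /F; case: unpickle => [[n k]|]; last by move=> /n0.
by case: asboolP => [Jj|_ /n0//] nkx; exists n, k.
Qed.

(** For almost every [x], the balls whose image under [Phi] contains [x]
    are exactly the balls that contain one particular point [y]; that point is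
    the value at [x] of the map realizing [Phi]. *)
Lemma Phi_point :
  {ae mu, forall x, exists y, forall n k, Q n k y <-> Phi (Q n k) x}.
Proof.
have mQ := scheme_measurable QS.
have cov : {ae mu, forall x, forall n, exists k, Phi (Q n k) x}.
  apply: ae_foralln => n; apply: filterS2 (PhiU (mQ n)) Phi_setT => x [QU _] Tx.
  apply: QU; rewrite (_ : \bigcup_k _ = setT) // -subTset => y _.
  by have [k] := scheme_cover QS n y; exists k.
apply: filterS3 cov (ae_forall_count Phi_fip) (ae_forall_count Phi_separate).
move=> x /choice[k kx] fip sep.
have fipx (h : nat -> nat) : (forall n, Phi (Q n (h n)) x) ->
    exists y, forall n, Q n (h n) y.
  move=> hx; apply: (scheme_fip QS) => N.
  have := fip (mkseq h N); rewrite size_mkseq.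
  have nthE n : (n < N)%N -> nth 0%N (mkseq h N) n = h n by exact: nth_mkseq.
  case=> [n nN|y yh]; first by rewrite nthE.
  by exists y => n nN; rewrite -nthE//; exact: yh.
have [y yk] := fipx k kx; exists y.
have PhiQ m j : Phi (Q m j) x -> Q m j y.
  move=> mj; pose h n := if n == m then j else k n.
  have [|z zh] := fipx h.
    by move=> n; rewrite /h; case: eqP => // ->.
  have <- : z = y.
    apply: (scheme_uniq QS (k := k) (N := m.+1)) => n mn //.
    by have := zh n; rewrite /h; case: eqP => // nm; rewrite nm ltnn in mn.
  by have := zh m; rewrite /h eqxx.
move=> m j; split; last exact: PhiQ.
move=> mjy; apply: contrapT => /(sep (m, j))[n [l [/PhiQ nly]]].
by move=> /(_ _ nly).
Qed.

(** The sets on which a map and [Phi] agree form a sigma-algebra; for the map given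
    by [Phi_point], it contains the balls, which generate. *)
Lemma point_realization : exists2 f : X -> X, measurable_fun setT f &
  forall A, measurable A -> {ae mu, forall x, A (f x) <-> Phi A x}.
Proof.
have mQ := scheme_measurable QS.
have [N [mN N0 NP]] := Phi_point.
have {}NP x : ~ N x -> exists y, forall n k, Q n k y <-> Phi (Q n k) x.
  by move=> nN; apply: contrapT => /NP.
have /choice[f fP] x : exists y, (N x -> y = x) /\
    (~ N x -> forall n k, Q n k y <-> Phi (Q n k) x).
  have [Nx|nNx] := pselect (N x); first by exists x; split.
  by have [y yP] := NP x nNx; exists y.
have aeN : {ae mu, forall x, ~ N x} by exact/(ae_measure0 _ mN).
pose C := [set A | [/\ measurable A, measurable (f @^-1` A) &
  {ae mu, forall x, A (f x) <-> Phi A x}]].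
suff CA A : measurable A -> C A.
  exists f; last by move=> A /CA[].
  by move=> _ A /CA[]; rewrite setTI.
move=> /(scheme_generate QS); apply: (@smallest_sub _ _ _ C); last first.
  move=> _ [n [k ->]]; split=> //.
    have -> : f @^-1` Q n k = (N `&` Q n k) `|` (~` N `&` Phi (Q n k)).
      apply/seteqP; split => x; rewrite /preimage /= => xQ.
        have [Nx|nNx] := pselect (N x).
          by left; split => //; move: xQ; rewrite (fP x).1.
        by right; split => //; apply/((fP x).2 nNx).
      case: xQ => -[Nx xQ]; first by rewrite (fP x).1.
      exact/((fP x).2 Nx).
    apply: measurableU; first exact: measurableI.
    by apply: measurableI; [exact: measurableC|exact: mPhi].
  by apply: filterS aeN => x /((fP x).2).
split.
- split; rewrite ?preimage_set0 //.
  by apply: filterS Phi_set0 => x n0; split => // /n0.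
- move=> B [mB mfB BP]; rewrite setTD; split; first exact: measurableC.
    by rewrite preimage_setC; exact: measurableC.
  apply: filterS2 BP (PhiC mB) => x fB CB; rewrite CB -fB.
  by split.
- move=> F CF; have mF n : measurable (F n) by case: (CF n).
  split; first exact: bigcup_measurable.
    by rewrite preimage_bigcup; apply: bigcup_measurable => n _; case: (CF n).
  have : {ae mu, forall x, forall n, F n (f x) <-> Phi (F n) x}.
    by apply: ae_foralln => n; case: (CF n).
  apply: filterS2 (PhiU mF) => x -> FP; split=> [[n _ /FP]|[n /FP]].
    by exists n.
  by exists n.
Qed.

End point_realization.

(** * Bijections defined piecewise *)

Section piecewise.
Context (R : realType) d (X : measurableType d) (mu : probability X R).

Lemma measure_bigcup_setT (F : nat -> set X) : (forall n, measurable (F n)) ->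
  trivIset setT F -> mu (\bigcup_n F n) = (\sum_(0 <= n <oo) mu (F n))%E.
Proof.
move=> mF tF; rewrite measure_semi_bigcup//; first exact: bigcup_measurable.
Qed.

(** A bijection that coincides with one of countably many measure-preserving
    maps on each piece of a countable measurable partition preserves measure:
    the images of the pieces form again a partition. *)
Lemma mp_piecewise_nat (h : nat -> mp_bij mu) (c : X -> nat) :
  (forall i, measurable [set x | c x = i]) ->
  injective (fun x => h (c x) x) -> (forall y, exists x, h (c x) x = y) ->
  exists s : mp_bij mu, forall x, s x = h (c x) x.
Proof.
set f := (fun x => h (c x) x) => mc injf /choice[g fg].
have gf : cancel f g by move=> x; apply: injf; exact: fg.
have gE x : mp_inv (h (c (g x))) x = g x.
  by rewrite -{2}(fg x) /f mp_funK.
have preE A : f @^-1` A = \bigcup_i ([set x | c x = i] `&` h i @^-1` A).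
  apply/seteqP; split => [x Ax|x [i _ [/= <-]//]].
  by exists (c x).
have preV A : g @^-1` A = \bigcup_i (mp_inv (h i) @^-1` ([set x | c x = i] `&` A)).
  apply/seteqP; split => [x Ax|x [i _ [/= ci Ai]]].
    by exists (c (g x)) => //; rewrite /= gE.
  suff <- : mp_inv (h i) x = g x by [].
  by apply: injf; rewrite /f fg ci mp_invK.
have mpi i A : measurable A -> measurable (mp_inv (h i) @^-1` A).
  exact: (@mp_preimage_measurable _ _ _ _ (mp_opp (h i))).
have mf A : measurable A -> measurable (f @^-1` A).
  move=> mA; rewrite preE; apply: bigcup_measurable => i _.
  by apply: measurableI => //; exact: mp_preimage_measurable.
have mg A : measurable A -> measurable (g @^-1` A).
  move=> mA; rewrite preV; apply: bigcup_measurable => i _.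
  by apply: mpi; exact: measurableI.
have mpf A : measurable A -> pushforward mu f A = mu A.
  move=> mA; rewrite /pushforward preE measure_bigcup_setT; first last.
  - by move=> i j _ _ [x [[/= <- _] [/= <-]]].
  - by move=> i; apply: measurableI => //; exact: mp_preimage_measurable.
  pose G i := mp_inv (h i) @^-1` [set x | c x = i] `&` A.
  have -> : mu A = mu (\bigcup_i G i).
    congr (mu _); rewrite -setI_bigcupl -[LHS]setTI; congr (_ `&` _).
    apply/esym; rewrite -subTset => x _; exists (c (g x)) => //=.
    by rewrite gE.
  rewrite measure_bigcup_setT; first last.
  - move=> i j _ _ [x [[/= ci _] [/= cj _]]].
    rewrite -ci -cj; congr (c _); apply: injf.
    by rewrite /f ci cj !mp_invK.
  - by move=> i; apply: measurableI => //; exact: mpi.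
  apply: eq_eseriesr => i _; rewrite -[RHS](mp_preimageE (h i)); last first.
    by apply: measurableI => //; exact: mpi.
  by congr (mu _); apply/seteqP; split => x; rewrite /G /= mp_funK.
have mfs : measurable_fun setT f by move=> _ A mA; rewrite setTI; exact: mf.
have mgs : measurable_fun setT g by move=> _ A mA; rewrite setTI; exact: mg.
by exists (MpBij gf fg mfs mgs mpf).
Qed.

Lemma mp_piecewise (I : countType) (h : I -> mp_bij mu) (c : X -> I) :
  (forall i, measurable [set x | c x = i]) ->
  injective (fun x => h (c x) x) -> (forall y, exists x, h (c x) x = y) ->
  exists s : mp_bij mu, forall x, s x = h (c x) x.
Proof.
move=> mc injf surjf.
pose h' k := if unpickle k is Some i then h i else mp_one mu.
have h'E x : h' (pickle (c x)) x = h (c x) x by rewrite /h' pickleK.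
have [|x y|y|s sE] := @mp_piecewise_nat h' (pickle \o c).
- move=> k /=; have [[i ik]|nk] := pselect (exists i : I, pickle i = k).
    rewrite (_ : [set _ | _] = [set x | c x = i])//.
    by apply/seteqP; split=> x /=; rewrite -ik; [move/(pcan_inj pickleK)|move=> ->].
  rewrite (_ : [set _ | _] = set0)//; apply/seteqP; split=> x //= ck.
  by apply: nk; exists (c x).
- by rewrite /= !h'E => /injf.
- by have [x fx] := surjf y; exists x; rewrite /= h'E.
- by exists s => x; rewrite sE /= h'E.
Qed.

End piecewise.

(** * Countable measurability *)

Section countable_measurability.
Context d (X : measurableType d) (I : countType).

Lemma measurable_ex_count (P : I -> X -> Prop) :
  (forall i, measurable [set x | P i x]) ->
  measurable [set x | exists i, P i x].
Proof.
move=> mP; rewrite (_ : [set _ | _] = \bigcup_i [set x | P i x]); last first.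
  by apply/seteqP; split => x /= [i]; exists i.
by apply: countable_bigcupT_measurable => //; exact: countableP.
Qed.

Lemma measurable_forall_count (P : I -> X -> Prop) :
  (forall i, measurable [set x | P i x]) ->
  measurable [set x | forall i, P i x].
Proof.
move=> mP.
rewrite (_ : [set _ | _] = ~` [set x | exists i, ~ P i x]); last first.
  apply/seteqP; split => x /= => [Px [i]|nP i]; first exact.
  by apply: contrapT => nPi; apply: nP; exists i.
apply: measurableC; apply: measurable_ex_count => i.
exact: (measurableC (mP i)).
Qed.

Lemma measurable_levels (c : X -> I) (A : set I) :
  (forall i, measurable [set x | c x = i]) -> measurable [set x | A (c x)].
Proof.
move=> mc; rewrite (_ : [set _ | _] = [set x | exists i, A i /\ c x = i]).
  apply: measurable_ex_count => i.
  have [Ai|nAi] := pselect (A i).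
    by rewrite (_ : [set _ | _] = [set x | c x = i])//; apply/seteqP; split => x //= [].
  by rewrite (_ : [set _ | _] = set0)//; apply/seteqP; split => x //= [].
by apply/seteqP; split => x /= => [Ax|[i [Ai ->]]//]; exists (c x).
Qed.

Lemma measurable_fun_levels d' (Y : measurableType d') (c : X -> I) (g : I -> Y) :
  (forall i, measurable [set x | c x = i]) -> measurable_fun setT (g \o c).
Proof.
by move=> mc _ A mA; rewrite setTI; exact: (measurable_levels (g @^-1` A)).
Qed.

End countable_measurability.

Section countable_levels.
Context d (X : measurableType d).

Lemma measurable_levels_comp (I J : countType) (g : I -> J) (c : X -> I) :
  (forall i, measurable [set x | c x = i]) ->
  forall j, measurable [set x | g (c x) = j].
Proof. by move=> mc j; exact: (measurable_levels [set i | g i = j] mc). Qed.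

Lemma measurable_levels_pair (I J : countType) (c : X -> I) (e : X -> J) :
  (forall i, measurable [set x | c x = i]) ->
  (forall j, measurable [set x | e x = j]) ->
  forall k, measurable [set x | (c x, e x) = k].
Proof.
move=> mc me [i j].
rewrite (_ : [set _ | _] = [set x | c x = i] `&` [set x | e x = j]).
  exact: measurableI.
by apply/seteqP; split => x /= => [[-> ->]|[-> ->]].
Qed.

End countable_levels.

(** * Automorphisms from maps inverse almost everywhere *)

Section realize_automorphism.
Context (R : realType) d (X : measurableType d) (mu : probability X R).
Variables (Q : nat -> nat -> set X) (QS : ball_scheme Q).

Lemma ae_comp_mp (f : X -> X) (P : X -> Prop) : measurable_fun setT f ->
  (forall A, measurable A -> mu (f @^-1` A) = mu A) ->
  {ae mu, forall x, P x} -> {ae mu, forall x, P (f x)}.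
Proof.
move=> mf muf [N [mN N0 PN]]; exists (f @^-1` N); split.
- exact: measurable_preimage.
- by rewrite muf.
- by move=> x /= Px; exact: PN.
Qed.

(** Two measure-preserving maps that are inverse to each other almost
    everywhere are so exactly on the conull set of points all of whose images
    under words in the two maps are good; outside of it the identity serves. *)
Lemma mp_bij_of_ae_inverse (f g : X -> X) :
  measurable_fun setT f -> measurable_fun setT g ->
  (forall A, measurable A -> mu (f @^-1` A) = mu A) ->
  (forall A, measurable A -> mu (g @^-1` A) = mu A) ->
  {ae mu, forall x, g (f x) = x} -> {ae mu, forall x, f (g x) = x} ->
  exists s : mp_bij mu, {ae mu, forall x, s x = f x}.
Proof.
move=> mf mg muf mug gf fg.
pose letter (b : bool) := if b then f else g.
pose word (w : seq bool) x := foldr letter x w.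
pose X0 := [set x | forall w, g (f (word w x)) = word w x /\ f (g (word w x)) = word w x].
have mword w : measurable_fun setT (word w).
  elim: w => [|b w IH]; first exact: measurable_id.
  by apply: (measurableT_comp _ IH); case: b.
have aeX0 : {ae mu, forall x, X0 x}.
  apply: ae_forall_count; elim/last_ind => [|w b IH]; first exact: filterI gf fg.
  have mb : measurable_fun setT (letter b) by case: b.
  have mub A : measurable A -> mu (letter b @^-1` A) = mu A.
    by case: b {mb}; [exact: muf|exact: mug].
  by apply: filterS (ae_comp_mp mb mub IH) => x; rewrite /word foldr_rcons.
have mX0 : measurable X0.
  apply: measurable_forall_count => w; apply: measurableI.
    apply: (measurable_eq_fun QS) => //.
    exact: (measurableT_comp mg (measurableT_comp mf (mword w))).
  apply: (measurable_eq_fun QS) => //.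
  exact: (measurableT_comp mf (measurableT_comp mg (mword w))).
have X0f x : X0 x -> X0 (f x).
  move=> Xx w; have := Xx (rcons w true).
  by rewrite /word foldr_rcons.
have X0g x : X0 x -> X0 (g x).
  move=> Xx w; have := Xx (rcons w false).
  by rewrite /word foldr_rcons.
pose s x := if `[< X0 x >] then f x else x.
pose r x := if `[< X0 x >] then g x else x.
have sr : cancel s r.
  move=> x; rewrite /s /r; case: (asboolP (X0 x)) => Xx; last by rewrite asboolF.
  by rewrite (asboolT (X0f _ Xx)); have [] := Xx [::].
have rs : cancel r s.
  move=> x; rewrite /s /r; case: (asboolP (X0 x)) => Xx; last by rewrite asboolF.
  by rewrite (asboolT (X0g _ Xx)); have [] := Xx [::].
have mif h : measurable_fun setT h ->
    measurable_fun setT (fun x => if `[< X0 x >] then h x else x).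
  move=> mh _ A mA; rewrite setTI.
  rewrite (_ : _ @^-1` _ = (X0 `&` h @^-1` A) `|` (~` X0 `&` A)).
    apply: measurableU; apply: measurableI => //; last exact: measurableC.
    exact: measurable_preimage.
  apply/seteqP; split => x /=; case: asboolP => Xx.
  - by left. - by right. - by case=> -[]. - by case=> -[].
have mps A : measurable A -> pushforward mu s A = mu A.
  move=> mA; rewrite -(muf A mA); apply: measure_eq_ae.
  - by apply: measurable_preimage => //; exact: mif.
  - exact: measurable_preimage.
  - by apply: filterS aeX0 => x Xx; rewrite /preimage /= /s; case: asboolP.
exists (MpBij sr rs (mif _ mf) (mif _ mg) mps).
by apply: filterS aeX0 => x Xx; rewrite /= /s asboolT.
Qed.

End realize_automorphism.

(** * Aperiodicity and recurrence *)

Section aperiodicity.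
Context (R : realType) d (X : measurableType d) (mu : probability X R).
Variables (Q : nat -> nat -> set X) (QS : ball_scheme Q).

Lemma measureC (A : set X) : measurable A -> mu (~` A) = (1 - mu A)%E.
Proof. by move=> mA; rewrite probability_setC. Qed.

Lemma nonatomic_half (A : set X) : nonatomic mu -> measurable A -> (0 < mu A)%E ->
  exists B, [/\ measurable B, (0 < mu B)%E & (2%:E * mu B <= mu A)%E].
Proof.
move=> na mA A0.
have [B [mB BA B0 BnA]] : exists B, [/\ measurable B, B `<=` A, mu B <> 0%E & mu B <> mu A].
  apply: contrapT => nB; apply: na; exists A; split => // B mB BA.
  by apply: contrapT => /not_orP[B0 BnA]; apply: nB; exists B.
have mD : measurable (A `\` B) by exact: measurableD.
have fB : mu B \is a fin_num by exact: fin_num_measure.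
have fD : mu (A `\` B) \is a fin_num by exact: fin_num_measure.
have AE : mu A = (mu (A `\` B) + mu B)%E.
  by rewrite (measureDI mu mA mB) (setIidr BA).
have B1 : (0 < mu B)%E by rewrite lt0e measure_ge0 andbT; exact/eqP.
have D1 : (0 < mu (A `\` B))%E.
  rewrite lt0e measure_ge0 andbT; apply/eqP => D0.
  by apply: BnA; rewrite AE D0 add0e.
rewrite AE; have [BD|DB] := leP (mu B) (mu (A `\` B)).
  exists B; split=> //; move: BD.
  by rewrite -(fineK fB) -(fineK fD) !lee_fin; lra.
exists (A `\` B); split=> //; move: DB.
by rewrite -(fineK fB) -(fineK fD) lte_fin lee_fin; lra.
Qed.

(** Iterated halving. *)
Lemma nonatomic_small (e : R) : nonatomic mu -> 0 < e ->
  exists A, [/\ measurable A, (0 < mu A)%E & (mu A < e%:E)%E].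
Proof.
move=> na e0.
have H n : exists A, [/\ measurable A, (0 < mu A)%E & ((2 ^+ n)%:E * mu A <= 1)%E].
  elim: n => [|n [A [mA A0 An]]].
    by exists setT; rewrite expr0 mul1e probability_setT; split.
  have [B [mB B0 BA]] := nonatomic_half na mA A0.
  exists B; split => //; apply: le_trans An.
  by rewrite exprSr EFinM -muleA lee_pmul2l// lte_fin exprn_gt0.
have [A [mA A0 An]] := H (Num.truncn e^-1).+1.
exists A; split => //; move: An A0.
have fA : mu A \is a fin_num by exact: fin_num_measure.
rewrite -(fineK fA) lee_fin !lte_fin => An A0.
have : e^-1 < 2 ^+ (Num.truncn e^-1).+1.
  apply: lt_trans (truncnS_gt _) _.
  by rewrite -natrX ltr_nat ltn_expl.
set p := 2 ^+ _ in An *; have p0 : 0 < p by exact: exprn_gt0.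
rewrite -[e^-1]div1r ltr_pdivrMr// => pe.
by rewrite -(ltr_pM2l p0); exact: le_lt_trans An pe.
Qed.

Definition aperiodic (t : mp_bij mu) :=
  {ae mu, forall x, forall n, mp_pow t n x = x -> n = 0}.

Lemma mp_pow_period (t : mp_bij mu) n x q :
  mp_pow t n x = x -> mp_pow t (q * n) x = x.
Proof.
move=> tn; elim: q => [|q IH|q IH]; first by rewrite mul0r.
  by rewrite intS mulrDl mul1r mp_powD IH.
have -> : - q.+1%:Z * n = - n + (- q%:Z * n) by lia.
by rewrite mp_powD IH -{1}tn mp_powK.
Qed.

(** If almost every point had period [n], then the [n] first images of a set
    of measure less than [1/n] would form an invariant set contradicting
    ergodicity. *)
Lemma ergodic_aperiodic (T : aut mu) : nonatomic mu -> ergodic T -> aperiodic T.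
Proof.
move=> na ergT.
have mE n : measurable [set x | mp_pow T n x = x].
  apply: (measurable_eq_fun QS); first exact: measurable_mp_fun.
  exact: measurable_id.
have pow_comm n m x : mp_pow T n (mp_pow T m x) = mp_pow T m (mp_pow T n x).
  by rewrite -!mp_powD addrC.
suff per0 (n : nat) : mu [set x | mp_pow T n.+1 x = x] = 0%E.
  have : {ae mu, forall x, forall n : nat, mp_pow T n.+1 x <> x}.
    by apply: ae_foralln => n; exact: (ae_measure0 mu (mE n.+1)).2 (per0 n).
  apply: filterS => x nx [[|n]|n] nn; rewrite ?NegzE in nn *; [by []|by case: (nx n)|].
  case: (nx n).
  by rewrite -[in LHS]nn mp_powNK.
have [//|x m /= xn|//|P1] := ergT [set x | mp_pow T n.+1 x = x].
  by rewrite aut_iterE pow_comm xn.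
exfalso.
have [A [mA A0 An]] := nonatomic_small na (e := n.+1%:R^-1) ltac:(by rewrite invr_gt0 ltr0n).
pose As := [set x | exists m : int, A (mp_pow T m x)].
have mAs : measurable As.
  by apply: measurable_ex_count => m; exact: mp_preimage_measurable.
pose B i := mp_pow T (Posz i) @^-1` A.
have mB i : measurable (B i) by exact: mp_preimage_measurable.
have AsB : {ae mu, forall x, As x <-> (\big[setU/set0]_(i < n.+1) B i) x}.
  have aeP : {ae mu, forall x, mp_pow T n.+1 x = x}.
    have : mu (~` [set x | mp_pow T n.+1 x = x]) = 0%E.
      by rewrite measureC// P1 subee.
    move=> /(ae_measure0 mu (measurableC (mE _))).
    by apply: filterS => x /contrapT.
  apply: filterS aeP => x xn; rewrite -bigcup_mkord; split => [[m Am]|[i _ Bi]]; last by exists i.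
  (* on points of period [n + 1] only the visit time modulo [n + 1] matters *)
  have n0 : n.+1%:Z != 0 by [].
  have [r rE] : exists r : nat, (m %% n.+1)%Z = r.
    by exists `|(m %% n.+1)%Z|%N; rewrite gez0_abs// modz_ge0.
  exists r.
    by have := ltz_pmod m (isT : 0 < n.+1%:Z); rewrite rE.
  by move: Am; rewrite {1}(divz_eq m n.+1) addrC mp_powD mp_pow_period// rE.
have As1 : mu As = 1%E.
  have [//|x m [k Ak]|As0|//] := ergT As.
    exists (k - m); rewrite aut_iterE -mp_powD.
    by rewrite (_ : k - m + m = k)//; lia.
  have : (mu A <= mu As)%E.
    by rewrite le_measure ?inE// => x Ax; exists 0.
  by rewrite As0 leNgt A0.
have mU : measurable (\big[setU/set0]_(i < n.+1) B i) by exact: bigsetU_measurable.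
have : (mu As <= \sum_(i < n.+1) mu (B i))%E.
  by rewrite (measure_eq_ae mAs mU AsB); exact: Boole_inequality.
rewrite As1.
have -> : (\sum_(i < n.+1) mu (B i) = \sum_(i < n.+1) mu A)%E.
  by apply: eq_bigr => i _; exact: mp_preimageE.
have fA : mu A \is a fin_num by exact: fin_num_measure.
move: An; rewrite -(fineK fA) sumEFin lte_fin lee_fin sumr_const card_ord => An.
apply/negP; rewrite -ltNge -mulr_natr.
by rewrite -ltr_pdivlMr ?ltr0n// mul1r.
Qed.

(** Poincare recurrence: the points of [A] that never return form a wandering
    set, whose infinitely many disjoint images have the same measure. *)
Lemma recurrence (t : mp_bij mu) A : measurable A ->
  {ae mu, forall x, A x -> exists n : nat, A (mp_pow t n.+1 x)}.
Proof.
move=> mA.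
pose W := [set x | A x /\ forall n : nat, ~ A (mp_pow t n.+1 x)].
have mW : measurable W.
  apply: measurableI => //; apply: measurable_forall_count => n.
  by apply: (measurableC (A := mp_pow t n.+1 @^-1` A)); exact: mp_preimage_measurable.
suff /(ae_measure0 mu mW) : mu W = 0%E.
  apply: filterS => x nW Ax; apply: contrapT => nA; apply: nW; split => // n tA.
  by apply: nA; exists n.
pose F i := mp_pow t (Posz i) @^-1` W.
have mF i : measurable (F i) by exact: mp_preimage_measurable.
have disj i k x : F i x -> ~ F (i + k.+1)%N x.
  move=> [_ /(_ k) nA] [+ _]; rewrite addnC PoszD mp_powD; exact: nA.
have tF : trivIset setT F.
  move=> i j _ _ [x [Fi Fj]].
  have [ij|ji|//] := ltngtP i j.
    by move: Fj; rewrite -(subnKC ij) addSnnS => /(disj _ _ _ Fi).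
  by move: Fi; rewrite -(subnKC ji) addSnnS => /(disj _ _ _ Fj).
have le1 n : ((n%:R * fine (mu W))%:E <= 1)%E.
  have <- : (\sum_(0 <= i < n) mu (F i) = (n%:R * fine (mu W))%:E)%E.
    transitivity (\sum_(0 <= i < n) mu W)%E.
      by apply: eq_bigr => i _; exact: mp_preimageE.
    have fW : mu W \is a fin_num by exact: fin_num_measure.
    by rewrite -{1}(fineK fW) sumEFin sumr_const_nat subn0 mulr_natl.
  apply: le_trans (nneseries_lim_ge _ _) _; first by move=> *; exact: measure_ge0.
  by rewrite -measure_bigcup_setT// probability_le1//; exact: bigcup_measurable.
have fW : mu W \is a fin_num by exact: fin_num_measure.
apply: contrapT => W0.
have W1 : 0 < fine (mu W).
  by rewrite fine_gt0// lt0e measure_ge0 andbT ltey_eq fW andbT; exact/eqP.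
have := le1 (Num.truncn (fine (mu W))^-1).+1; apply/negP.
rewrite -ltNge lte_fin -ltr_pdivrMr// mul1r.
exact: truncnS_gt.
Qed.

End aperiodicity.

(** * Cocycles and the integrable full group *)

Section cocycles.
Context (R : realType) d (X : measurableType d) (mu : probability X R).
Variables (Q : nat -> nat -> set X) (QS : ball_scheme Q).
Implicit Types (T U V : aut mu) (c e : X -> int).

Definition levels_measurable (I : Type) (c : X -> I) :=
  forall n, measurable [set x | c x = n].

Definition int_norm1 c : \bar R := \int[mu]_x (`|(c x)%:~R : R|)%:E.

Lemma integral_mp (s : mp_bij mu) (f : X -> \bar R) : measurable_fun setT f ->
  (forall x, 0 <= f x)%E -> (\int[mu]_x f (s x) = \int[mu]_x f x)%E.
Proof.
move=> mf f0.
have -> : (\int[mu]_x f x = \int[pushforward mu s]_x f x)%E.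
  apply: eq_measure_integral => [|ms A mA _]; first exact: measurable_mp_fun.
  exact: (esym (mp_funP s mA)).
by rewrite ge0_integral_pushforward//; exact: measurable_mp_fun.
Qed.

Lemma measurable_int_norm c : levels_measurable c ->
  measurable_fun setT (fun x => (`|(c x)%:~R : R|)%:E).
Proof.
move=> mc.
exact: (measurable_fun_levels (fun n : int => (`|n%:~R : R|)%:E) mc).
Qed.

Lemma int_norm1_le c e : levels_measurable c -> levels_measurable e ->
  {ae mu, forall x, `|c x| <= `|e x|} -> (int_norm1 c <= int_norm1 e)%E.
Proof.
move=> mc me ce; apply: ae_ge0_le_integral => //.
- exact: measurable_int_norm.
- exact: measurable_int_norm.
- by apply: filterS ce => x ce _; rewrite lee_fin -!intr_norm ler_int.
Qed.

Lemma int_norm1_add c e : levels_measurable c -> levels_measurable e ->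
  (int_norm1 (fun x => (c x + e x)%R) <= int_norm1 c + int_norm1 e)%E.
Proof.
move=> mc me; have mce := measurable_levels_pair mc me.
rewrite -ge0_integralD//; try exact: measurable_int_norm.
apply: ge0_le_integral => //.
- apply: measurable_int_norm => n.
  exact: (measurable_levels_comp (fun i : int * int => i.1 + i.2) mce).
- by apply: emeasurable_funD; exact: measurable_int_norm.
- by move=> x _; rewrite -EFinD lee_fin intrD ler_normD.
Qed.

Lemma int_norm1_cst n : (int_norm1 (fun=> n) < +oo)%E.
Proof.
rewrite /int_norm1 integral_cst//; apply: lte_mul_pinfty => //.
by rewrite -ge0_fin_numE ?measure_ge0//; exact: fin_num_measure.
Qed.

Lemma levels_measurable_cst (I : Type) (k : I) : levels_measurable (fun=> k).
Proof.
move=> n; have [kn|nkn] := pselect (k = n).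
  by rewrite (_ : [set _ | _] = setT)// -subTset.
by rewrite (_ : [set _ | _] = set0)//; apply/seteqP; split.
Qed.

Lemma levels_asbool (A : set X) : measurable A ->
  levels_measurable (fun x => `[< A x >] : bool).
Proof.
move=> mA; case.
  by rewrite (_ : [set _ | _] = A)//; apply/seteqP; split => x /asboolP.
rewrite (_ : [set _ | _] = ~` A); first exact: measurableC.
by apply/seteqP; split => x /= => [/asboolPn|nA]; last exact/asboolPn.
Qed.

Lemma int_norm1_mp (s : mp_bij mu) c : levels_measurable c ->
  int_norm1 (fun x => c (s x)) = int_norm1 c.
Proof.
move=> mc; rewrite /int_norm1.
by rewrite (integral_mp s (f := fun x => (`|(c x)%:~R : R|)%:E))//; exact: measurable_int_norm.
Qed.

Lemma levels_measurable_mp I (s : mp_bij mu) (c : X -> I) :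
  levels_measurable c -> levels_measurable (fun x => c (s x)).
Proof. by move=> mc n; exact: (mp_preimage_measurable s (mc n)). Qed.

Let good T U n := [set x | forall m, U x = mp_pow T m x <-> m = n].

Lemma cocycleE T U x n :
  cocycle T U x = n <-> good T U n x \/ n = 0 /\ forall m, ~ good T U m x.
Proof.
rewrite /cocycle.
have -> : [set n0 | forall m, U x = aut_iter T m x <-> m = n0] =
    [set n0 | good T U n0 x].
  by apply/funext => k; apply/propext; split => gk m; have := gk m; rewrite aut_iterE.
have gI k l : good T U k x -> good T U l x -> k = l.
  by move=> gk gl; apply/gl/gk.
case: xgetP => [k _ gk|ng]; split.
- by move=> <-; left.
- by case=> [gn|[_ ng]]; [exact: gI gk gn|case: (ng k gk)].
- by move=> <-; right; split => // m; exact: ng.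
- by case=> [/ng|[]].
Qed.

Lemma measurable_eq_pow T U m : measurable [set x | U x = mp_pow T m x].
Proof. by apply: (measurable_eq_fun QS); exact: measurable_mp_fun. Qed.

Lemma measurable_cocycle T U : levels_measurable (cocycle T U).
Proof.
move=> n.
have mg k : measurable (good T U k).
  apply: measurable_forall_count => m; have mE := measurable_eq_pow T U m.
  have [mk|nmk] := pselect (m = k).
    rewrite (_ : [set _ | _] = [set x | U x = mp_pow T m x])//.
    by apply/seteqP; split=> x /=; [case=> _; apply|split].
  rewrite (_ : [set _ | _] = ~` [set x | U x = mp_pow T m x]); first exact: measurableC.
  by apply/seteqP; split=> x /= => [[h _] /h|nE]; [exact: nmk|split].
rewrite (_ : [set _ | _] = good T U n `|` [set x | n = 0 /\ forall m, ~ good T U m x]); last first.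
  by apply/seteqP; split=> x /= /cocycleE.
apply: measurableU => //; have [n0|nn0] := pselect (n = 0).
  rewrite (_ : [set _ | _] = [set x | forall m, ~ good T U m x]).
    by apply: measurable_forall_count => m; exact: (measurableC (mg m)).
  by apply/seteqP; split=> x /= => [[]//|]; split.
by rewrite (_ : [set _ | _] = set0)//; apply/seteqP; split=> x //= [].
Qed.

Lemma mp_pow_inj (t : mp_bij mu) x m n : (forall k, mp_pow t k x = x -> k = 0) ->
  mp_pow t m x = mp_pow t n x -> m = n.
Proof.
move=> ap mn; apply/eqP; rewrite -subr_eq0; apply/eqP/ap.
by rewrite addrC mp_powD mn mp_powK.
Qed.

Lemma cocycle_ae T U c : aperiodic T ->
  {ae mu, forall x, U x = mp_pow T (c x) x} ->
  {ae mu, forall x, cocycle T U x = c x}.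
Proof.
move=> apT; apply: filterS2 apT => x ap Uc; apply/cocycleE; left => m.
by rewrite Uc; split => [/(mp_pow_inj ap)//|->].
Qed.

Lemma cocycleP T U : aperiodic T -> full_group T U ->
  {ae mu, forall x, U x = mp_pow T (cocycle T U x) x}.
Proof.
move=> apT; apply: filterS2 apT => x ap [n]; rewrite aut_iterE => Un.
rewrite (_ : cocycle T U x = n)//; apply/cocycleE; left => m.
by rewrite Un; split => [/(mp_pow_inj ap)//|->].
Qed.

Lemma L1_cocycle T U : aperiodic T -> L1_full_group T U ->
  [/\ levels_measurable (cocycle T U),
      {ae mu, forall x, U x = mp_pow T (cocycle T U x) x} &
      (int_norm1 (cocycle T U) < +oo)%E].
Proof.
move=> apT [fU LU]; split => //; first exact: measurable_cocycle.
exact: cocycleP.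
Qed.

Lemma L1_intro T U c : aperiodic T -> levels_measurable c ->
  {ae mu, forall x, U x = mp_pow T (c x) x} -> (int_norm1 c < +oo)%E ->
  L1_full_group T U.
Proof.
move=> apT mc Uc Lc; split.
  by apply: filterS Uc => x Ux; exists (c x); rewrite aut_iterE.
apply: le_lt_trans Lc; apply: int_norm1_le => //.
  exact: measurable_cocycle.
by apply: filterS (cocycle_ae apT Uc) => x ->.
Qed.

Lemma L1_full_group1 T : aperiodic T -> L1_full_group T 1%g.
Proof.
move=> apT; apply: (@L1_intro _ _ (fun=> 0)) => //.
- exact: levels_measurable_cst.
- exact: aut_one_ae.
- exact: int_norm1_cst.
Qed.

Lemma L1_full_groupT T : aperiodic T -> L1_full_group T T.
Proof.
move=> apT; apply: (@L1_intro _ _ (fun=> 1)) => //.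
- exact: levels_measurable_cst.
- by apply: aeW => x; rewrite mp_pow1.
- exact: int_norm1_cst.
Qed.

Lemma L1_full_groupM T U V : aperiodic T ->
  L1_full_group T U -> L1_full_group T V -> L1_full_group T (U * V)%g.
Proof.
move=> apT /(L1_cocycle apT)[mU cU LU] /(L1_cocycle apT)[mV cV LV].
have mUV : levels_measurable (fun x => cocycle T U (V x)) by exact: levels_measurable_mp.
apply: (@L1_intro _ _ (fun x => cocycle T U (V x) + cocycle T V x)) => //.
- move=> n; apply: (measurable_levels_comp (fun i : int * int => i.1 + i.2)
    (measurable_levels_pair mUV mV)).
- apply: filterS3 (aut_mul_ae U V) (ae_mp_comp V cU) cV => x -> -> Vx.
  by rewrite mp_powD -Vx.
- apply: le_lt_trans (int_norm1_add mUV mV) _.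
  by rewrite int_norm1_mp// lte_add_pinfty.
Qed.

Lemma L1_full_groupV T U : aperiodic T -> L1_full_group T U ->
  L1_full_group T (U^-1)%g.
Proof.
move=> apT /(L1_cocycle apT)[mU cU LU].
have mUi : levels_measurable (fun x => cocycle T U (mp_opp U x)).
  exact: levels_measurable_mp.
apply: (@L1_intro _ _ (fun x => - cocycle T U (mp_opp U x))) => //.
- by move=> n; exact: (measurable_levels_comp (fun i : int => - i) mUi).
- apply: filterS2 (aut_inv_ae U) (ae_mp_comp (mp_opp U) cU) => x -> /=.
  rewrite mp_invK => /(congr1 (mp_pow T (- cocycle T U (mp_inv U x)))).
  by rewrite mp_powK.
- rewrite (_ : int_norm1 _ = int_norm1 (cocycle T U))//.
  rewrite -(int_norm1_mp (mp_opp U) mU).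
  by apply: eq_integral => x _; rewrite intrN normrN.
Qed.

(** If [U] preserves [B], so does every power of it on a conull set; cutting
    there makes the restriction a genuine bijection. *)
Lemma L1_full_group_restrict T U B : aperiodic T -> L1_full_group T U ->
  measurable B -> {ae mu, forall x, B (U x) <-> B x} ->
  exists V, L1_full_group T V /\ {ae mu, forall x,
    (B x -> V x = U x) /\ (~ B x -> V x = x)}.
Proof.
move=> apT LU mB UB.
pose B0 := [set x | forall n, B (mp_pow U n x)].
have mB0 : measurable B0.
  by apply: measurable_forall_count => n; exact: mp_preimage_measurable.
have B0B : {ae mu, forall x, B0 x <-> B x}.
  apply: filterS (ae_orbit U UB) => x Ux; split => [/(_ 0)//|Bx].
  elim => [|n IH|n IH] //; first by rewrite intS addrC mp_powS; apply/Ux.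
  have -> : - n.+1%:Z = - n%:Z - 1 by lia.
  by apply/Ux; rewrite -mp_powS subrK.
have B0U x : B0 (U x) <-> B0 x.
  split=> Bx n.
    by have := Bx (n - 1); rewrite -(mp_pow1 U x) -mp_powD subrK.
  by have := Bx (n + 1); rewrite mp_powD mp_pow1.
pose b x : bool := `[< B0 x >].
have mb : levels_measurable b by exact: levels_asbool.
pose h (b : bool) : mp_bij mu := if b then U : mp_bij mu else mp_one mu.
have bU x : b (U x) = b x by apply/asboolP/asboolP => /B0U.
have bh x : b (h (b x) x) = b x by rewrite {1}/h; case bx : (b x) => //; rewrite bU.
have [|y|s sE] := mp_piecewise (h := h) mb.
- move=> x y xy; have bxy : b x = b y by rewrite -bh xy bh.
  by move: xy; rewrite /= bxy; apply: can_inj; exact: mp_funK.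
- exists (mp_inv (h (b y)) y).
  have -> : b (mp_inv (h (b y)) y) = b y.
    case yB : (b y); rewrite /h /=; last exact: yB.
    by rewrite -yB -[in RHS](mp_invK U y) bU.
  by rewrite mp_invK.
exists (aut_of s); split; last first.
  apply: filterS2 (aut_ofE s) B0B => x -> BE; rewrite sE /h /b; split => Bx.
    by rewrite asboolT//; apply/BE.
  by rewrite asboolF// => /BE.
have [mU cU L1U] := L1_cocycle apT LU.
pose c x := if b x then cocycle T U x else 0.
have mc : levels_measurable c.
  by move=> n; exact: (measurable_levels_comp (fun i : bool * int => if i.1 then i.2 else 0)
    (measurable_levels_pair mb mU)).
apply: (L1_intro (c := c)) => //.
  apply: filterS2 (aut_ofE s) cU => x -> Ux; rewrite sE /c /h.
  by case: (b x).
apply: le_lt_trans L1U; apply: int_norm1_le => //.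
by apply: aeW => x; rewrite /c; case: ifP => // _; rewrite normr0.
Qed.

(** The transformation equal to [T^n] on [B], to [T^-n] on [T^n B] and to the
    identity elsewhere: its cocycle is bounded, hence integrable. *)
Lemma L1_full_group_exchange T n B : aperiodic T -> measurable B ->
  (forall x, B x -> ~ B (mp_pow T n x)) ->
  exists V, [/\ L1_full_group T V, (V * V = 1)%g,
    {ae mu, forall x, B x -> V x = mp_pow T n x} &
    {ae mu, forall x, ~ B x -> ~ B (mp_pow T (- n) x) -> V x = x}].
Proof.
move=> apT mB disj.
pose t := mp_pow T n.
have disj' x : B x -> ~ B (mp_pow T (- n) x).
  by move=> Bx /disj; rewrite mp_powNK.
pose c x : int := if `[< B x >] then n else
  if `[< B (mp_pow T (- n) x) >] then - n else 0.
have mB' : measurable (mp_pow T (- n) @^-1` B) by exact: mp_preimage_measurable.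
have mc : levels_measurable c.
  by move=> k; exact: (measurable_levels_comp
    (fun i : bool * bool => if i.1 then n else if i.2 then - n else 0)
    (measurable_levels_pair (levels_asbool mB) (levels_asbool mB'))).
pose f x := mp_pow T (c x) x.
have ff x : f (f x) = x.
  rewrite /f /c; case: (asboolP (B x)) => [Bx|nBx].
    rewrite asboolF; last exact: disj.
    by rewrite mp_powK asboolT// mp_powK.
  case: (asboolP (B (mp_pow T (- n) x))) => [Bx'|nBx'].
    by rewrite asboolT// mp_powNK.
  by rewrite mp_pow0 asboolF// asboolF.
have [|y|s sE] := mp_piecewise (h := mp_pow T) mc.
- exact: (can_inj ff).
- by exists (f y); exact: ff.
exists (aut_of s); split.
- apply: (L1_intro (c := c)) => //.
    by apply: filterS (aut_ofE s) => x ->.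
  apply: (@le_lt_trans _ _ (int_norm1 (fun=> n))).
    apply: int_norm1_le => //; first exact: levels_measurable_cst.
    apply: aeW => x; rewrite /c; do 2 case: ifP => _ //; rewrite ?normrN //.
  exact: int_norm1_cst.
- apply/aut_eqP; have sA := aut_ofE s.
  apply: filterS3 (aut_mul_ae (aut_of s) (aut_of s)) (aut_one_ae mu)
    (filterI sA (ae_mp_comp (aut_of s) sA)) => x -> -> [+ ->].
  by rewrite !sE => ->; exact: ff.
- by apply: filterS (aut_ofE s) => x -> Bx; rewrite sE /c asboolT.
- by apply: filterS (aut_ofE s) => x -> Bx Bx'; rewrite sE /c asboolF// asboolF.
Qed.

End cocycles.

(** * Supports and commutants *)

(** For an involution [p] of a group [G] with many involutions,
    [local_pieces G p] contains the cuts of [p] to its invariant sets and only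
    elements supported in the support of [p]; the other notions use it to
    isolate, in the language of groups, the elements with this support
    (see [support_subgroupE]). *)
Section commutants.
Variable gT : groupType.
Implicit Types (G : set gT) (p : gT).
Local Open Scope group_scope.

Definition commutant G p := [set x | G x /\ x * p = p * x].

Definition local_pieces G p := [set x | [/\ commutant G p x, x * x = 1 &
  forall y, commutant G p y -> x * (y * x * y^-1) = (y * x * y^-1) * x]].

Definition piece_commutant G p :=
  [set x | G x /\ forall y, local_pieces G p y -> x * y = y * x].

Definition support_subgroup G p :=
  [set x | G x /\ forall y, piece_commutant G p y -> x * (y * y) = (y * y) * x].

End commutants.

Section supports.
Context (R : realType) d (X : measurableType d) (mu : probability X R).
Variables (Q : nat -> nat -> set X) (QS : ball_scheme Q).
Implicit Types (U V f p r s : aut mu) (A B : set X).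

Definition supported U A := {ae mu, forall x, ~ A x -> U x = x}.

Definition moved U : set X := [set x | U x <> x].

Lemma measurable_moved U : measurable (moved U).
Proof.
apply: (measurableC (A := [set x | U x = x])); apply: (measurable_eq_fun QS).
  exact: measurable_mp_fun.
exact: measurable_id.
Qed.

Lemma supported_moved U : supported U (moved U).
Proof. by apply: aeW => x; rewrite /moved /= => /contrapT. Qed.

Lemma supported1 U : supported U set0 <-> U = 1%g.
Proof.
rewrite /supported; split=> [U0|->].
  apply/aut_eqP; apply: filterS2 U0 (aut_one_ae mu) => x U0 ->; exact: U0.
by apply: filterS (aut_one_ae mu).
Qed.

Lemma supportedS U A B : {ae mu, forall x, A x -> B x} ->
  supported U A -> supported U B.
Proof. by rewrite /supported => AB UA; apply: filterS2 AB UA => x AB UA nB; apply: UA => /AB. Qed.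

Lemma supported_stable U A : supported U A -> {ae mu, forall x, A (U x) <-> A x}.
Proof.
rewrite /supported => UA; apply: filterS2 UA (ae_mp_comp U UA) => x UAx UAU.
split=> [AU|Ax]; apply: contrapT => nA.
  by apply: (nA); rewrite -(UAx nA).
apply: (nA); have /(can_inj (mp_funK U)) Ux := UAU nA.
by rewrite Ux.
Qed.

Lemma supportedM U V A : supported U A -> supported V A -> supported (U * V)%g A.
Proof.
rewrite /supported => UA VA; apply: filterS3 (aut_mul_ae U V) UA VA => x -> Ux Vx nA.
by rewrite Vx// Ux.
Qed.

Lemma supported_disjoint_comm U V A B :
  {ae mu, forall x, A x -> B x -> False} -> supported U A -> supported V B ->
  (U * V = V * U)%g.
Proof.
move=> AB UA VB; apply/aut_eqP.
have AU := supported_stable UA; have BV := supported_stable VB.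
move: UA VB; rewrite /supported => UA VB.
apply: filterS3 (filterI (aut_mul_ae U V) (aut_mul_ae V U))
  (filterI (filterI UA (ae_mp_comp V UA)) (filterI VB (ae_mp_comp U VB)))
  (filterI (filterI AB (filterI (ae_mp_comp U AB) (ae_mp_comp V AB)))
    (filterI AU BV)) => x.
move=> [-> ->] [[Ux UVx] [Vx VUx]] [[ABx [ABU ABV]] [AUx BVx]].
have [Ax|nAx] := pselect (A x).
  by rewrite (Vx (ABx Ax)) VUx//; apply: ABU; apply/AUx.
rewrite (Ux nAx); have [Bx|nBx] := pselect (B x); last by rewrite (Vx nBx) Ux.
by rewrite UVx// => /ABV; apply; apply/BVx.
Qed.

(** A transformation that is not the identity on [A] moves some non-null
    subset of [A] off itself, since countably many sets separate points. *)
Lemma separate_moved U A : measurable A ->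
  ~ {ae mu, forall x, A x -> U x = x} ->
  exists B, [/\ measurable B, B `<=` A, mu B <> 0%E & forall x, B x -> ~ B (U x)].
Proof.
move=> mA nU; apply: contrapT => nB; apply: nU.
have mQ := scheme_measurable QS.
pose B (i : nat * nat) := A `&` (Q i.1 i.2 `&` ~` (U @^-1` Q i.1 i.2)).
have mB i : measurable (B i).
  apply: measurableI => //; apply: measurableI => //; apply: measurableC.
  exact: mp_preimage_measurable.
have aeB : {ae mu, forall x, forall i, ~ B i x}.
  apply: ae_forall_count => i; apply/(ae_measure0 mu (mB i)); apply: contrapT => B0.
  apply: nB; exists (B i); split => //; first by move=> x [].
  by move=> x [_ [_ nQ]] [_ [/nQ]].
apply: filterS aeB => x nBx Ax; apply: contrapT => /nesym/(scheme_neq QS)[n [k [xQ UQ]]].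
by apply: (nBx (n, k)).
Qed.

Lemma not_ae_restrict A (P : X -> Prop) : measurable A ->
  mu A <> 0%E -> {ae mu, forall x, A x -> P x} -> exists2 x, A x & P x.
Proof.
move=> mA A0 AP; apply: contrapT => nP; apply: A0; apply/(ae_measure0 mu mA).
by apply: filterS AP => x APx Ax; apply: nP; exists x; [|exact: APx].
Qed.

(** What the reconstruction of a transformation from an abstract isomorphism
    uses of a group of automorphisms. Exhausting a set by the supports of
    countably many involutions replaces the suprema of the measure algebra. *)
Record many_involutions (G : set (aut mu)) : Prop := ManyInvolutions {
  mi1 : G 1%g;
  miM : forall U V, G U -> G V -> G (U * V)%g;
  miV : forall U, G U -> G (U^-1)%g;
  mi_exhaust : forall A, measurable A -> exists p : nat -> aut mu,
    (forall n, [/\ G (p n), (p n * p n = 1)%g & supported (p n) A]) /\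
    {ae mu, forall x, A x -> exists n, p n x <> x};
  mi_cut : forall p B, G p -> (p * p = 1)%g -> measurable B ->
    {ae mu, forall x, B (p x) <-> B x} -> exists r, G r /\
      {ae mu, forall x, (B x -> r x = p x) /\ (~ B x -> r x = x)}
}.

Section commutant_lemmas.
Variables (G : set (aut mu)) (GI : many_involutions G).

Lemma mi_involution A : measurable A -> mu A <> 0%E ->
  exists p, [/\ G p, (p * p = 1)%g, supported p A & p <> 1%g].
Proof.
move=> mA A0; have [p [pG pA]] := mi_exhaust GI mA.
apply: contrapT => np.
have p1 n : p n = 1%g.
  apply: contrapT => pn1; apply: np; exists (p n).
  by have [Gp pp pnA] := pG n; split.
have : {ae mu, forall x, A x -> False}.
  apply: filterS2 pA (aut_one_ae mu) => x pAx one1 /pAx[n]; rewrite p1; exact.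
by move=> /(not_ae_restrict mA A0)[].
Qed.

Lemma involution_ae p : (p * p = 1)%g -> {ae mu, forall x, p (p x) = x}.
Proof.
move=> pp; have := aut_mul_ae p p; rewrite pp.
by move=> H; apply: filterS2 H (aut_one_ae mu) => x <- ->.
Qed.

(** An involution followed by an involution inside a set moved off itself by
    the first one has a nontrivial square. *)
Lemma mi_square A : measurable A -> mu A <> 0%E ->
  exists s, [/\ G s, supported s A & (s * s)%g <> 1%g].
Proof.
move=> mA A0; have [p [Gp pp pA p1]] := mi_involution mA A0.
have [|B [mB BA B0 Bp]] := @separate_moved p A mA.
  move=> pid; apply: p1; apply/aut_eqP; move: pA; rewrite /supported => pA.
  apply: filterS3 pid pA (aut_one_ae mu) => x pid pA ->.
  by have [/pid|/pA] := pselect (A x).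
have [r [Gr rr rB r1]] := mi_involution mB B0.
have rA : supported r A by apply: supportedS rB; exact: aeW.
exists (p * r)%g; split; [exact: (miM GI)|exact: supportedM|].
move=> pr1; apply: r1; apply/aut_eqP.
have rBs := supported_stable rB.
have pr := aut_mul_ae p r.
have prx : {ae mu, forall x, p (r (p (r x))) = x}.
  apply: filterS3 (involution_ae pr1) pr (ae_mp_comp (p * r : aut mu)%g pr) => x.
  by move=> + pr1x pr2x; rewrite pr2x pr1x.
move: rB; rewrite /supported => rB.
apply: filterS3 (filterI prx (aut_one_ae mu))
  (filterI rB (ae_mp_comp r (ae_mp_comp p rB)))
  (filterI rBs (ae_mp_comp r (involution_ae pp))) => x.
move=> [prprx ->] [rx rprx] [rBx pprx]; have [Bx|/rx//] := pselect (B x).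
by move: prprx; rewrite rprx ?pprx//; apply: Bp; apply/rBx.
Qed.

(** If [f] moves a part [C] of [B] off itself, it does not commute with a nontrivial
    square supported in [C], as it displaces the support of that square. *)
Lemma mi_centralizer f B : measurable B ->
  (forall s, G s -> supported s B -> (f * (s * s) = (s * s) * f)%g) ->
  {ae mu, forall x, B x -> f x = x}.
Proof.
move=> mB comm; apply: contrapT => nf.
have [C [mC CB C0 Cf]] := separate_moved mB nf.
have [s [Gs sC ss1]] := mi_square mC C0.
apply: ss1; apply/aut_eqP; set q := (s * s)%g.
have qC : supported q C by exact: supportedM.
have sB : supported s B by apply: supportedS sC; exact: aeW.
have fq := comm s Gs sB; rewrite -/q in fq.
have fqx := aut_mul_ae f q; have qfx := aut_mul_ae q f; rewrite fq in fqx.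
move: qC; rewrite /supported => qC.
apply: filterS3 (filterI fqx qfx) (filterI qC (ae_mp_comp f qC)) (aut_one_ae mu) => x.
move=> [fqx' qfx'] [qx qfx0] ->; have [Cx|/qx//] := pselect (C x).
by apply: (can_inj (mp_funK f)); rewrite -fqx' qfx' qfx0//; exact: Cf.
Qed.

Definition piece p B r :=
  {ae mu, forall x, (B x -> r x = p x) /\ (~ B x -> r x = x)}.

Definition stable p B := {ae mu, forall x, B (p x) <-> B x}.

Lemma piece_setT p : piece p setT p.
Proof. by apply: aeW => x; split => // nT; case: nT. Qed.

Lemma piece_comm p B C r s : (p * p = 1)%g -> stable p B -> stable p C ->
  piece p B r -> piece p C s -> (r * s = s * r)%g.
Proof.
rewrite /stable /piece => pp pB pC rB sC; apply/aut_eqP.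
apply: filterS3 (filterI (aut_mul_ae r s) (aut_mul_ae s r))
  (filterI (filterI rB (ae_mp_comp s rB)) (filterI sC (ae_mp_comp r sC)))
  (filterI pB pC) => x.
move=> [-> ->] [[[rx rnx] [rsx rnsx]] [[sx snx] [srx snrx]]] [Bp Cp].
have [Bx|nBx] := pselect (B x); have [Cx|nCx] := pselect (C x).
- move: rsx srx; rewrite (rx Bx) (sx Cx) => r2 s2.
  by rewrite r2 ?s2//; [apply/Cp|apply/Bp].
- move: rsx snrx; rewrite (rx Bx) (snx nCx) => r2 s2.
  by rewrite r2 ?s2// => /Cp.
- move: rnsx srx; rewrite (rnx nBx) (sx Cx) => r2 s2.
  by rewrite r2 ?s2// => /Bp.
- move: rnsx snrx; rewrite (rnx nBx) (snx nCx) => r2 s2.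
  by rewrite r2 ?s2.
Qed.

Lemma conj_ae f s : {ae mu, forall x, aut_repr (s * f * s^-1)%g x = s (f (mp_inv s x))}.
Proof.
apply: filterS3 (aut_mul_ae (s * f)%g (s^-1)%g)
  (ae_mp_comp (s^-1 : aut mu)%g (aut_mul_ae s f)) (aut_inv_ae s) => x -> /= + <-.
by [].
Qed.

Lemma piece_conj p B r s : (s * p = p * s)%g -> piece p B r ->
  piece p (mp_inv s @^-1` B) (s * r * s^-1)%g.
Proof.
rewrite /piece => sp rB.
have spx := aut_mul_ae s p; rewrite sp in spx.
have H := ae_mp_comp (mp_opp s).
apply: filterS3 (conj_ae r s) (filterI (H _ spx) (H _ (aut_mul_ae p s))) (H _ rB).
move=> x -> /= [sp1 sp2] [rx rnx]; split => Bx.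
  by rewrite rx// -sp1 sp2 mp_invK.
by rewrite rnx// mp_invK.
Qed.

Lemma stable_conj p B s : (s * p = p * s)%g -> stable p B ->
  stable p (mp_inv s @^-1` B).
Proof.
rewrite /stable => sp pB.
have spx := aut_mul_ae s p; rewrite sp in spx.
have H := ae_mp_comp (mp_opp s).
apply: filterS3 (H _ spx) (H _ (aut_mul_ae p s)) (H _ pB) => x /= sp1 sp2 pBx.
by move: sp1; rewrite sp2 mp_invK => ->; rewrite /= mp_funK.
Qed.

(** All pieces of [p], and all their conjugates by elements commuting with [p],
    act on each [p]-orbit by [p] or by the identity, so they commute. *)
Lemma piece_local p B r : G p -> (p * p = 1)%g -> measurable B -> stable p B ->
  G r -> piece p B r -> local_pieces G p r.
Proof.
move=> Gp pp mB pB Gr rB; have pT : stable p setT by apply: aeW.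
split; first by split => //; apply: piece_comm pB pT rB (piece_setT p).
  apply/aut_eqP; move: rB pB; rewrite /piece /stable => rB pB.
  apply: filterS3 (filterI (aut_mul_ae r r) (aut_one_ae mu))
    (filterI rB (ae_mp_comp r rB)) (filterI pB (involution_ae pp)) => x.
  move=> [-> ->] [[rx rnx] [rrx rrnx]] [Bp ppx].
  have [Bx|nBx] := pselect (B x); last by rewrite rnx// rnx.
  by move: rrx; rewrite rx// => ->//; apply/Bp.
move=> s [Gs sp].
exact: piece_comm pp pB (stable_conj sp pB) rB (piece_conj sp rB).
Qed.

(** A piece moving points outside the support of [p] would have to commute
    with its conjugates by elements supported off [moved p]; this forces the
    squares of those elements to be trivial. *)
Lemma local_pieces_supported p f : local_pieces G p f -> supported f (moved p).
Proof.
move=> [[Gf fp] ff fconj]; apply: contrapT => nf.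
have mA := measurable_moved p.
have [|B [mB BA B0 Bf]] := @separate_moved f (~` moved p) (measurableC mA).
  by [].
have [s [Gs sB ss1]] := mi_square mB B0.
have sp : (s * p = p * s)%g.
  apply: supported_disjoint_comm sB (supported_moved p).
  by apply: aeW => x /BA.
have fs := fconj s (conj Gs sp).
apply: ss1; apply/aut_eqP.
have fx := aut_mul_ae f (s * f * s^-1)%g; have xf := aut_mul_ae (s * f * s^-1)%g f.
rewrite fs in fx.
have ffx := involution_ae ff.
have sst := supported_stable sB.
move: sB; rewrite /supported => sB.
have I := ae_mp_comp (mp_opp s).
apply: filterS3 (filterI (filterI (aut_mul_ae s s) (aut_one_ae mu)) (filterI fx xf))
  (filterI (filterI (conj_ae f s) (ae_mp_comp f (conj_ae f s)))
           (filterI (filterI ffx (I _ ffx)) (I _ sst)))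
  (filterI (filterI sB (ae_mp_comp f sB)) (I _ (ae_mp_comp f sB))) => x.
move=> [[-> ->] [-> E]] [[c1 c2] [[ffx' ffy] /= sty]] [[sx sfx] sfy].
move: E; rewrite c1 c2.
have [Bx|nBx] := pselect (B x); last by rewrite !sx.
have By : B (mp_inv s x) by apply/sty; rewrite mp_invK.
rewrite (sfy (Bf _ By)) ffy.
have -> : mp_inv s (f x) = f x.
  by apply: (can_inj (mp_funK s)); rewrite mp_invK sfx//; exact: Bf.
by rewrite ffx' => <-; rewrite mp_invK.
Qed.

(** An element commuting with all pieces of [p] maps each [p]-orbit inside the
    support of [p] to itself, hence squares to the identity there. *)
Lemma piece_commutant_square p f : G p -> (p * p = 1)%g -> piece_commutant G p f ->
  supported (f * f)%g (~` moved p).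
Proof.
move=> Gp pp [Gf fcomm].
have mQ := scheme_measurable QS.
(* a [p]-invariant set containing [x] and missing [f x] must miss [p (f x)] as
   well: two separations at once, whence intersections of two basic sets *)
pose C (i : nat * nat * (nat * nat)) := Q i.1.1 i.1.2 `&` Q i.2.1 i.2.2.
pose B i := C i `|` p @^-1` C i.
have mB i : measurable (B i).
  by apply: measurableU; [|apply: mp_preimage_measurable]; exact: measurableI.
have pB i : stable p (B i).
  rewrite /stable; apply: filterS (involution_ae pp) => x ppx.
  rewrite /B /=; split => -[]; rewrite /preimage /= ?ppx; by [left|right].
have fp : (f * p = p * f)%g.
  apply: fcomm; apply: (piece_local Gp pp measurableT) (piece_setT p) => //.
  exact: aeW.
have BE : {ae mu, forall x, forall i, moved p x -> B i x -> B i (f x)}.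
  apply: ae_forall_count => i.
  have [r [Gr rB]] := mi_cut GI Gp pp (mB i) (pB i).
  have fr := fcomm r (piece_local Gp pp (mB i) (pB i) Gr rB).
  have frx := aut_mul_ae f r; have rfx := aut_mul_ae r f; rewrite fr in frx.
  apply: filterS3 (filterI frx rfx) rB (ae_mp_comp f rB) => x [-> rfx'].
  move=> [rx _] [_ rf] px Bx; apply: contrapT => /rf rf'.
  by apply: px; apply: (can_inj (mp_funK f)); rewrite -(rx Bx) rfx'.
have fpx := aut_mul_ae f p; rewrite fp in fpx.
have ppx := involution_ae pp.
rewrite /supported.
apply: filterS3 (filterI (aut_mul_ae f f) (filterI fpx (aut_mul_ae p f)))
  (filterI ppx (ae_mp_comp f ppx)) BE => x.
move=> [-> [pf pf']] [ppx' ppfx] BEx /contrapT px.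
have [fxx|fx] := pselect (f x = x); first by rewrite !fxx.
have [fxp|fxp] := pselect (f x = p x).
  by rewrite fxp -pf pf' fxp ppx'.
exfalso.
have [n [k [xn fxn]]] : exists n k, Q n k x /\ ~ Q n k (f x).
  by apply: (scheme_neq QS) => E; apply: fx; rewrite -E.
have [m [l [xm pfxm]]] : exists n k, Q n k x /\ ~ Q n k (p (f x)).
  by apply: (scheme_neq QS) => E; apply: fxp; rewrite [in RHS]E ppfx.
have := BEx ((n, k), (m, l)) px; case=> [|[]|[_]] //.
by left.
Qed.

(** The squares of [piece_commutant G p] are supported off the support of [p],
    and every square of an element supported off it occurs among them; so
    commuting with them is being supported in the support of [p]. The left-hand
    side is invariant under abstract isomorphisms. *)
Lemma support_subgroupE p f : G p -> (p * p = 1)%g ->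
  support_subgroup G p f <-> G f /\ supported f (moved p).
Proof.
move=> Gp pp; have mA := measurable_moved p.
split=> [[Gf fcomm]|[Gf fA]]; split => //.
  have mAC := measurableC mA.
  suff : {ae mu, forall x, (~` moved p) x -> f x = x} by [].
  apply: mi_centralizer => // s Gs sA; apply: fcomm; split => // y /local_pieces_supported yA.
  by apply: supported_disjoint_comm sA yA; apply: aeW => x.
move=> y yp; apply: supported_disjoint_comm fA (piece_commutant_square Gp pp yp).
by apply: aeW => x px npx.
Qed.

(** As the supports of suitable involutions exhaust any measurable set, this
    expresses being supported in an arbitrary set by commutation alone. *)
Lemma supported_centralizer f (p : nat -> aut mu) : G f ->
  (forall n, G (p n) /\ (p n * p n = 1)%g) ->
  (forall n s, support_subgroup G (p n) s -> (f * s = s * f)%g) <->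
  supported f (~` \bigcup_n moved (p n)).
Proof.
move=> Gf pP; split=> [comm|fA n s].
  have : {ae mu, forall x, forall n, moved (p n) x -> f x = x}.
    apply: ae_foralln => n; apply: mi_centralizer; first exact: measurable_moved.
    move=> s Gs sA; have [Gp pp] := pP n; apply: (comm n).
    by apply/support_subgroupE => //; split; [exact: (miM GI)|exact: supportedM].
  rewrite /supported; apply: filterS => x fx /contrapT[n _]; exact: fx.
have [Gp pp] := pP n; move=> /(support_subgroupE _ Gp pp)[Gs sA].
by apply: supported_disjoint_comm fA sA; apply: aeW => x /= nx px; apply: nx; exists n.
Qed.

(** The centralizer of the elements supported in [A] is exactly the group of
    those supported in the complement; thus complements are seen by abstract
    isomorphisms. *)
Lemma supported_compl f A : G f -> measurable A ->
  (forall s, G s -> supported s A -> (f * s = s * f)%g) <-> supported f (~` A).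
Proof.
move=> Gf mA; split=> [comm|fA s Gs sA].
  have : {ae mu, forall x, A x -> f x = x}.
    apply: mi_centralizer => // s Gs sA; apply: comm; first exact: (miM GI).
    exact: supportedM.
  by rewrite /supported; apply: filterS => x fx /contrapT.
by apply: supported_disjoint_comm fA sA; apply: aeW.
Qed.

Lemma supported_mono A B : measurable A -> measurable B ->
  (forall s, G s -> supported s A -> supported s B) ->
  {ae mu, forall x, A x -> B x}.
Proof.
move=> mA mB AB; have mD : measurable (A `\` B) by exact: measurableD.
apply: contrapT => nAB.
have [|p [Gp pp pD p1]] := @mi_involution (A `\` B) mD.
  move=> D0; apply: nAB; have /(ae_measure0 mu mD) := D0.
  by apply: filterS => x nD Ax; apply: contrapT => nB; apply: nD.
apply: p1; apply/supported1.
have : supported p B.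
  by apply: AB => //; apply: supportedS pD; apply: aeW => x [].
move: pD; rewrite /supported => pD pB.
apply: filterS2 pD pB => x pD pB _; have [Bx|/pB//] := pselect (B x).
by apply: pD => -[].
Qed.

End commutant_lemmas.

End supports.

(** * Involutions in the integrable full group *)

Section L1_rich.
Context (R : realType) d (X : measurableType d) (mu : probability X R).
Variables (Q : nat -> nat -> set X) (QS : ball_scheme Q).

(** The involutions exchanging [D] and [T^n D], for [D] the part of [A] inside
    one ball and with image outside of it, exhaust [A] by recurrence. *)
Lemma L1_many_involutions (T : aut mu) : aperiodic T ->
  many_involutions (L1_full_group T).
Proof.
move=> apT; split.
- exact: L1_full_group1 QS _ apT.
- by move=> U V; exact: (L1_full_groupM QS apT).
- by move=> U; exact: (L1_full_groupV QS apT).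
- move=> A mA; have mQ := scheme_measurable QS.
  pose D (i : nat * (nat * nat)) := (A `&` mp_pow T i.1.+1 @^-1` A) `&`
    (Q i.2.1 i.2.2 `&` ~` (mp_pow T i.1.+1 @^-1` Q i.2.1 i.2.2)).
  have mD i : measurable (D i).
    apply: measurableI; apply: measurableI => //; try apply: measurableC;
      exact: mp_preimage_measurable.
  have disj i x : D i x -> ~ D i (mp_pow T i.1.+1 x).
    by move=> [_ [_ nQ]] [_ [/nQ]].
  have /choice[q qP] i := L1_full_group_exchange QS apT (mD i) (disj i).
  pose p n := if unpickle n is Some i then q i else 1%g.
  exists p; split=> [n|].
    rewrite /p; case: (unpickle n) => [i|]; last first.
      split; [exact: L1_full_group1 QS _ apT|exact: mulg1|].
      exact/(supportedS _ ((supported1 _).2 erefl))/aeW.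
    have [Lq qq qD qnD] := qP i; split => //.
    rewrite /supported; apply: filterS qnD => x qx nA; apply: qx.
      by move=> [[]].
    by move=> [[_ /=]]; rewrite mp_powNK.
  have qx : {ae mu, forall x, forall i, D i x -> q i x = mp_pow T i.1.+1 x}.
    by apply: ae_forall_count => i; case: (qP i).
  apply: filterS3 (recurrence T mA) apT qx => x rec ap qx Ax.
  have [n tA] := rec Ax.
  have [|j [k [xQ txQ]]] := scheme_neq QS (x := x) (y := mp_pow T n.+1 x).
    by move=> /esym/ap.
  have Dx : D (n, (j, k)) x by [].
  exists (pickle (n, (j, k))); rewrite /p pickleK qx// => /ap //.
- move=> p B Lp _ mB pB.
  exact: L1_full_group_restrict QS _ _ _ apT Lp mB pB.
Qed.

End L1_rich.

(** * Transport of supports by a group isomorphism *)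

Section group_transport.
Variables (gT : groupType) (G H : set gT) (q : gT -> gT).
Hypothesis qiso : group_isomorphism G H q.
Hypothesis G1 : G 1%g.
Hypothesis GM : forall x y, G x -> G y -> G (x * y)%g.
Hypothesis GV : forall x, G x -> G (x^-1)%g.
Implicit Types x y p : gT.
Local Open Scope group_scope.

Lemma iso_in x : G x -> H (q x).
Proof. by case: qiso => -[+ _ _] _; apply. Qed.

Lemma iso_inj x y : G x -> G y -> q x = q y -> x = y.
Proof. by case: qiso => -[_ + _] _ Gx Gy; apply; rewrite inE. Qed.

Lemma iso_surj y : H y -> exists2 x, G x & q x = y.
Proof. by case: qiso => -[_ _ +] _ => /[apply]. Qed.

Lemma isoM x y : G x -> G y -> q (x * y) = q x * q y.
Proof. by case: qiso => _; apply. Qed.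

Lemma iso1 : q 1 = 1.
Proof.
have := isoM G1 G1; rewrite mulg1 => /(congr1 (fun z => (q 1)^-1 * z)).
by rewrite mulgA mulVg mul1g.
Qed.

Lemma isoV x : G x -> q x^-1 = (q x)^-1.
Proof.
move=> Gx; apply: (mulgI (q x)).
by rewrite -isoM ?mulgV ?iso1//; exact: GV.
Qed.

Lemma iso_comm x y : G x -> G y -> x * y = y * x <-> q x * q y = q y * q x.
Proof.
move=> Gx Gy; rewrite -!isoM//; split => [->//|]; exact: iso_inj (GM _ _) (GM _ _).
Qed.

Lemma iso_commutant p x : G p -> G x -> commutant G p x <-> commutant H (q p) (q x).
Proof.
move=> Gp Gx; split=> -[_ xp]; split => //; try exact: iso_in.
  by apply/(iso_comm Gx Gp).
by apply/(iso_comm Gx Gp).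
Qed.

Lemma iso_local_pieces p x : G p -> G x ->
  local_pieces G p x <-> local_pieces H (q p) (q x).
Proof.
move=> Gp Gx; have Gc y : G y -> G (y * x * y^-1).
  by move=> Gy; apply: GM; [exact: GM|exact: GV].
have qc y : G y -> q (y * x * y^-1) = q y * q x * (q y)^-1.
  by move=> Gy; rewrite !isoM ?isoV//; [exact: GM|exact: GV].
split=> -[xp xx xc]; split.
- exact/iso_commutant.
- by rewrite -isoM// xx iso1.
- move=> y' yp; have [y Gy yE] : exists2 y, G y & q y = y'.
    by apply: iso_surj; case: yp.
  rewrite -yE -qc//; apply/(iso_comm Gx (Gc y Gy)).
  by apply: xc; apply/iso_commutant => //; rewrite yE.
- by apply/iso_commutant.
- by apply: iso_inj => //; [exact: GM|rewrite isoM// xx iso1].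
- move=> y yp; have Gy : G y by case: yp.
  apply/(iso_comm Gx (Gc y Gy)).
  by rewrite qc//; apply: xc; apply/iso_commutant.
Qed.

Lemma iso_piece_commutant p x : G p -> G x ->
  piece_commutant G p x <-> piece_commutant H (q p) (q x).
Proof.
move=> Gp Gx; split=> -[_ xc]; split => //; first exact: iso_in.
- move=> y' yp; have [y Gy yE] : exists2 y, G y & q y = y'.
    by apply: iso_surj; case: yp => -[].
  rewrite -yE; apply/(iso_comm Gx Gy).
  by apply: xc; apply/iso_local_pieces => //; rewrite yE.
- move=> y yp; have Gy : G y by case: yp => -[].
  by apply/(iso_comm Gx Gy); apply: xc; apply/iso_local_pieces.
Qed.

Lemma iso_support_subgroup p x : G p -> G x ->
  support_subgroup G p x <-> support_subgroup H (q p) (q x).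
Proof.
move=> Gp Gx; split=> -[_ xc]; split => //; first exact: iso_in.
- move=> y' yp; have [y Gy yE] : exists2 y, G y & q y = y'.
    by apply: iso_surj; case: yp.
  rewrite -yE -isoM//; apply/(iso_comm Gx (GM Gy Gy)).
  by apply: xc; apply/iso_piece_commutant => //; rewrite yE.
- move=> y yp; have Gy : G y by case: yp.
  apply/(iso_comm Gx (GM Gy Gy)).
  by rewrite isoM//; apply: xc; apply/iso_piece_commutant.
Qed.

End group_transport.

Lemma iso_inverse (gT : groupType) (G H : set gT) (q : gT -> gT) :
  (forall x y, G x -> G y -> G (x * y)%g) ->
  group_isomorphism G H q -> exists p : gT -> gT, [/\ group_isomorphism H G p,
    forall x, G x -> p (q x) = x & forall y, H y -> q (p y) = y].
Proof.
move=> GM qiso.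
have /choice[p pP] y : exists x, H y -> G x /\ q x = y.
  have [Hy|nHy] := pselect (H y); last by exists 1%g.
  by have [x Gx xy] := iso_surj qiso Hy; exists x.
have pq x : G x -> p (q x) = x.
  move=> Gx; have [Gp qp] := pP (q x) (iso_in qiso Gx).
  exact: (iso_inj qiso).
exists p; split => //; last by move=> y /pP[].
split; first split.
- by move=> y /pP[].
- move=> x y; rewrite !inE => /pP[_ qx] /pP[_ qy] xy.
  by rewrite -qx -qy xy.
- by move=> x Gx; exists (q x); [exact: iso_in qiso _ Gx|exact: pq].
- move=> x y /pP[Gx qx] /pP[Gy qy].
  by rewrite -{1}qx -{1}qy -(isoM qiso)// pq//; exact: GM.
Qed.

Section support_transport.
Context (R : realType) d (X : measurableType d) (mu : probability X R).
Variables (Q : nat -> nat -> set X) (QS : ball_scheme Q).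
Implicit Types (A B : set X).

(** A set is known to the abstract group through the subgroup of the elements
    supported in it; on the side of [G] and on the side of its image, that
    subgroup determines the set up to a null set. *)
Definition support_match (G : set (aut mu)) (q : aut mu -> aut mu) A A' :=
  forall f, G f -> supported f A <-> supported (q f) A'.

Section direct.
Variables (G H : set (aut mu)) (q : aut mu -> aut mu).
Hypotheses (GI : many_involutions G) (HI : many_involutions H).
Hypothesis qiso : group_isomorphism G H q.
Let G1 := mi1 GI.
Let GM := miM GI.
Let GV := miV GI.

(** The elements supported in [A] form the centralizer of the subgroups attached
    to countably many involutions exhausting the complement of [A], and these
    subgroups are characterized algebraically. *)
Lemma support_match_exists A : measurable A ->
  exists A', measurable A' /\ support_match G q A A'.
Proof.
move=> mA; have [p [pG pA]] := mi_exhaust GI (measurableC mA).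
pose A' := ~` \bigcup_n moved (q (p n)).
exists A'; split.
  apply: measurableC; apply: bigcup_measurable => n _; exact: (measurable_moved QS).
move=> f Gf.
have pP n : G (p n) /\ (p n * p n = 1)%g by case: (pG n).
have qpP n : H (q (p n)) /\ (q (p n) * q (p n) = 1)%g.
  have [Gp pp] := pP n; split; first exact: iso_in qiso _ Gp.
  by rewrite -(isoM qiso)// pp (iso1 qiso G1).
have -> : supported f A <-> supported f (~` \bigcup_n moved (p n)).
  have pAs : {ae mu, forall x, forall n, ~ (~` A) x -> p n x = x}.
    by apply: ae_foralln => n; case: (pG n).
  split; apply: supportedS; last first.
    apply: filterS pA => x pA nx; apply: contrapT => /pA[n pn].
    by apply: nx; exists n.
  by apply: filterS pAs => x pAs Ax [n _]; apply; apply: pAs.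
have qf := iso_in qiso Gf.
rewrite -(supported_centralizer QS GI Gf pP) -(supported_centralizer QS HI qf qpP).
split=> comm n s.
  move=> sp; have [t Gt tE] : exists2 t, G t & q t = s.
    by apply: (iso_surj qiso); case: sp.
  rewrite -tE; apply/(iso_comm qiso GM Gf Gt); apply: (comm n).
  have [Gp _] := pP n.
  by apply/(iso_support_subgroup qiso G1 GM GV Gp Gt); rewrite tE.
move=> sp; have Gs : G s by case: sp.
apply/(iso_comm qiso GM Gf Gs); apply: (comm n); have [Gp _] := pP n.
by apply/(iso_support_subgroup qiso G1 GM GV Gp Gs).
Qed.

Lemma support_match_mono A A' B B' : measurable A' -> measurable B' ->
  support_match G q A A' -> support_match G q B B' ->
  {ae mu, forall x, A x -> B x} -> {ae mu, forall x, A' x -> B' x}.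
Proof.
move=> mA mB AA BB AB; apply: (supported_mono HI mA mB) => s Hs.
have [f Gf <-] := iso_surj qiso Hs.
move=> /(AA f Gf) fA; apply/(BB f Gf); exact: supportedS fA.
Qed.

Lemma support_match_uniq A A' A'' : measurable A' -> measurable A'' ->
  support_match G q A A' -> support_match G q A A'' ->
  {ae mu, forall x, A' x <-> A'' x}.
Proof.
move=> mA mB AA BB; have I : {ae mu, forall x, A x -> A x} by apply: aeW.
by apply: filterS2 (support_match_mono mA mB AA BB I)
  (support_match_mono mB mA BB AA I).
Qed.

Lemma support_match_compl A A' : measurable A -> measurable A' ->
  support_match G q A A' -> support_match G q (~` A) (~` A').
Proof.
move=> mA mA' AA f Gf; have Hf := iso_in qiso Gf.
rewrite -(supported_compl QS GI Gf mA) -(supported_compl QS HI Hf mA').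
split=> comm s Gs.
  have [t Gt <-] := iso_surj qiso Gs; move=> /(AA t Gt) tA.
  by apply/(iso_comm qiso GM Gf Gt); exact: comm.
move=> /(AA s Gs) sA; apply/(iso_comm qiso GM Gf Gs); apply: comm => //.
exact: iso_in qiso _ Gs.
Qed.

Lemma support_match_bigcap (A A' : nat -> set X) :
  (forall n, support_match G q (A n) (A' n)) ->
  support_match G q (\bigcap_n A n) (\bigcap_n A' n).
Proof.
move=> AA f Gf.
have capE (g : aut mu) (B : nat -> set X) :
    supported g (\bigcap_n B n) <-> forall n, supported g (B n).
  split=> [gB n|gB].
    by apply: supportedS gB; apply: aeW => x Bx; exact: Bx.
  have : {ae mu, forall x, forall n, ~ B n x -> g x = x} by apply: ae_foralln.
  rewrite /supported; apply: filterS => x Bx /existsNP[n /not_implyP[_]].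
  exact: Bx.
by rewrite !capE; split=> fA n; apply/(AA n).
Qed.

Lemma support_match_bigcup (A A' : nat -> set X) :
  (forall n, measurable (A n)) -> (forall n, measurable (A' n)) ->
  (forall n, support_match G q (A n) (A' n)) ->
  support_match G q (\bigcup_n A n) (\bigcup_n A' n).
Proof.
move=> mA mA' AA; rewrite -[\bigcup_n A n]setCK -[\bigcup_n A' n]setCK !setC_bigcup.
have mC (B : nat -> set X) : (forall n, measurable (B n)) ->
    measurable (\bigcap_n ~` B n).
  by move=> mB; apply: bigcapT_measurable => n; exact: measurableC.
apply: support_match_compl; [exact: mC|exact: mC|].
by apply: support_match_bigcap => n; exact: support_match_compl.
Qed.

(** Conjugation moves supports by [U]; this makes the correspondence of supports
    equivariant, and later identifies [q] with a conjugation. *)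
Lemma supported_conj (U f : aut mu) A :
  supported f (U @^-1` A) <-> supported (U * f * U^-1)%g A.
Proof.
rewrite /supported; split=> fA.
  apply: filterS2 (conj_ae f U) (ae_mp_comp (mp_opp U) fA) => x -> fAx nA.
  by rewrite fAx /= mp_invK.
apply: filterS2 (ae_mp_comp U (conj_ae f U)) (ae_mp_comp U fA) => x.
move=> /= -> + nA => /(_ nA); rewrite mp_funK; exact: (can_inj (mp_funK U)).
Qed.

Lemma support_match_preimage A A' (U : aut mu) : G U ->
  support_match G q A A' -> support_match G q (U @^-1` A) (q U @^-1` A').
Proof.
move=> GU AA f Gf; rewrite !supported_conj.
rewrite -(isoV qiso G1 GV GU) -!(isoM qiso)//; [|exact: GM|exact: GV].
by apply: AA; apply: GM; [exact: GM|exact: GV].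
Qed.

(** The correspondence of supports is a sigma-complete Boolean isomorphism of
    measure algebras, so it is induced by a point map. *)
Lemma support_match_realized : exists2 f : X -> X, measurable_fun setT f &
  forall A A', measurable A -> measurable A' -> support_match G q A A' ->
    {ae mu, forall x, A (f x) <-> A' x}.
Proof.
have /choice[Phi PhiP] A : exists A', measurable A ->
    measurable A' /\ support_match G q A A'.
  have [mA|nmA] := pselect (measurable A); last by exists set0.
  by have [A' ?] := support_match_exists mA; exists A'.
have mPhi A : measurable A -> measurable (Phi A) by move=> /PhiP[].
have sPhi A : measurable A -> support_match G q A (Phi A) by move=> /PhiP[].
have [| |f mf fP] := point_realization QS (mu := mu) mPhi.
- move=> A mA; apply: support_match_uniq (sPhi _ (measurableC mA)) _.
  + exact/mPhi/measurableC.
  + exact/measurableC/mPhi.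
  + by apply: support_match_compl => //; [exact: mPhi|exact: sPhi].
- move=> F mF; have : {ae mu, forall x, Phi (\bigcup_n F n) x <-> (\bigcup_n Phi (F n)) x}.
    have mU : measurable (\bigcup_n F n) by exact: bigcup_measurable.
    apply: support_match_uniq (sPhi _ mU) _.
    + exact: mPhi.
    + by apply: bigcup_measurable => n _; exact: mPhi.
    + by apply: support_match_bigcup => n //; [exact: mPhi|exact: sPhi].
  by apply: filterS => x ->; split=> -[n]; exists n.
exists f => // A A' mA mA' AA.
apply: filterS2 (fP A mA) (support_match_uniq (mPhi A mA) mA' (sPhi A mA) AA).
by move=> x -> ->.
Qed.

End direct.
End support_transport.

(** * Invariant measures and reconstruction *)

Section unique_ergodicity.
Context (R : realType) d (X : measurableType d) (mu nu : probability X R).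
Variable T : aut mu.
Hypothesis ergT : ergodic T.
Hypothesis nuT : forall A, measurable A -> nu (T @^-1` A) = nu A.
Hypothesis nu_mu : forall A, measurable A -> mu A = 0%E -> nu A = 0%E.

Lemma nu_pow n A : measurable A -> nu (mp_pow T n @^-1` A) = nu A.
Proof.
move=> mA; have mpA m : measurable (mp_pow T m @^-1` A) by exact: mp_preimage_measurable.
elim: n => [|n IH|n IH].
- by congr (nu _); apply/seteqP; split.
- rewrite -IH -(nuT (mpA n)); congr (nu _); apply/seteqP; split => x /=;
    by rewrite intS addrC -[T x]mp_pow1 -mp_powD.
- rewrite -IH -(nuT (mpA (- n.+1%:Z))); congr (nu _); apply/seteqP; split => x /=;
    by rewrite -[T x]mp_pow1 -mp_powD (_ : - n.+1%:Z + 1 = - n%:Z)//; lia.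
Qed.

(** The comparison on the set of points whose orbit meets [P] follows from that
    on [P] by cutting the set according to the time of the visit. *)
Lemma orbit_le (m1 m2 : probability X R) (P : set X) :
  (forall n A, measurable A -> m1 (mp_pow T n @^-1` A) = m1 A) ->
  (forall n A, measurable A -> m2 (mp_pow T n @^-1` A) = m2 A) ->
  measurable P ->
  (forall A, measurable A -> A `<=` P -> (m1 A <= m2 A)%E) ->
  forall A, measurable A -> (forall x, A x -> exists n, P (mp_pow T n x)) ->
  (m1 A <= m2 A)%E.
Proof.
move=> m1T m2T mP P12 A mA AP.
pose pw k := mp_pow T (odflt 0 (unpickle k)).
pose F k := A `&` pw k @^-1` P.
have mF k : measurable (F k) by apply: measurableI => //; exact: mp_preimage_measurable.
have AE : A = \bigcup_k seqDU F k.
  rewrite -seqDU_bigcup_eq; apply/seteqP; split => [x Ax|x [k _ []//]].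
  by have [n Pn] := AP x Ax; exists (pickle n) => //; split; rewrite // /pw /= pickleK.
have mD k : measurable (seqDU F k) by apply: measurableD => //; exact: bigsetU_measurable.
rewrite AE !measure_bigcup_setT//; try exact: trivIset_seqDU.
apply: lee_nneseries => [k _ _|k _]; first exact: measure_ge0.
pose B := mp_inv (pw k) @^-1` seqDU F k.
have mB : measurable B by exact: (mp_preimage_measurable (mp_opp (pw k))).
have DE : seqDU F k = pw k @^-1` B.
  by apply/seteqP; split => x; rewrite /B /= mp_funK.
rewrite DE m1T// m2T//; apply: P12 => // x /(@subset_seqDU _ F k)[_ /=].
by rewrite mp_invK.
Qed.

(** The orbit of a positive set of the Hahn decomposition of [nu - mu] is again
    positive and invariant, hence null or conull; in either case one of the two
    probability measures dominates the other. *)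
Lemma ergodic_invariant_measure A : measurable A -> nu A = mu A.
Proof.
have dom_eq (m1 m2 : probability X R) :
    (forall B, measurable B -> (m1 B <= m2 B)%E) -> forall B, measurable B -> m1 B = m2 B.
  move=> m12 B mB; apply/eqP; rewrite eq_le m12//=.
  have := m12 (~` B) (measurableC mB); rewrite !probability_setC//.
  have f1 : m1 B \is a fin_num by exact: fin_num_measure.
  have f2 : m2 B \is a fin_num by exact: fin_num_measure.
  by rewrite -(fineK f1) -(fineK f2) -!EFinB !lee_fin; lra.
have [P [N [[mP posP] [mN negN] PN _]]] := Hahn_decomposition
  (cadd (charge_of_finite_measure nu) (copp (charge_of_finite_measure mu))).
have fin (m : probability X R) B : measurable B -> m B \is a fin_num.
  by move=> mB; exact: fin_num_measure.
pose Ps := [set x | exists n, P (mp_pow T n x)].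
have mPs : measurable Ps.
  by apply: measurable_ex_count => n; exact: mp_preimage_measurable.
have mupow n B : measurable B -> mu (mp_pow T n @^-1` B) = mu B.
  exact: mp_preimageE.
have [//|x n [k Pk]|Ps0|Ps1] := ergT (A := Ps).
- by exists (k - n); rewrite aut_iterE -mp_powD subrK.
- apply: dom_eq => B mB.
  have BN : measurable (B `\` Ps) by exact: measurableD.
  have -> : nu B = nu (B `\` Ps).
    have E := measureDI nu mB mPs.
    rewrite E [X in (_ + X)%E](_ : _ = 0%E) ?adde0//.
    apply: nu_mu; first exact: measurableI.
    apply/eqP; rewrite eq_le measure_ge0 andbT -Ps0.
    by rewrite le_measure ?inE//; exact: measurableI.
  apply: (@le_trans _ _ (mu (B `\` Ps))); last first.
    by rewrite le_measure ?inE//; apply: subDsetl.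
  have := negN _ BN; rewrite /cadd /copp /charge_of_finite_measure /=.
  rewrite sube_le0; apply => x [Bx nPs].
  have : (P `|` N) x by rewrite PN.
  by case=> // Px; case: nPs; exists 0.
- move=> mA; apply/esym; apply: dom_eq mA => B mB.
  have BI : measurable (B `&` Ps) by exact: measurableI.
  have -> : mu B = mu (B `&` Ps).
    have E := measureDI mu mB mPs.
    rewrite E [X in (X + _)%E](_ : _ = 0%E) ?add0e//.
    apply/eqP; rewrite eq_le measure_ge0 andbT.
    have <- : mu (~` Ps) = 0%E by rewrite probability_setC// Ps1 subee.
    by rewrite le_measure ?inE//; [exact: measurableD|exact: measurableC].
  apply: (@le_trans _ _ (nu (B `&` Ps))); last first.
    by rewrite le_measure ?inE//; apply: subIsetl.
  apply: (orbit_le mupow nu_pow mP _ BI); last by move=> x [].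
  move=> C mC CP; have := posP _ mC CP.
  by rewrite /cadd /copp /charge_of_finite_measure /= sube_ge0// fin.
Qed.

End unique_ergodicity.

Section reconstruction.
Context (R : realType) d (X : measurableType d) (mu : probability X R).
Variables (Q : nat -> nat -> set X) (QS : ball_scheme Q).
Variables (G H : set (aut mu)) (q : aut mu -> aut mu).
Hypotheses (GI : many_involutions G) (HI : many_involutions H).
Hypothesis qiso : group_isomorphism G H q.

(** A null set corresponds to a null set, because supports in null sets force the
    identity. *)
Lemma match_map_null (G' H' : set (aut mu)) (q' : aut mu -> aut mu) (f : X -> X) :
  many_involutions G' -> many_involutions H' -> group_isomorphism G' H' q' ->
  measurable_fun setT f ->
  (forall A A', measurable A -> measurable A' -> support_match G' q' A A' ->
    {ae mu, forall x, A (f x) <-> A' x}) ->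
  forall P : X -> Prop, {ae mu, forall x, P x} -> {ae mu, forall x, P (f x)}.
Proof.
move=> GI' HI' qiso' mf fP P [N [mN N0 PN]].
have [N' [mN' NN]] := support_match_exists QS GI' HI' qiso' mN.
have s0 : support_match G' q' set0 set0.
  move=> s Gs; rewrite !supported1; split=> [->|qs]; first exact: iso1 qiso' (mi1 GI').
  by apply: (iso_inj qiso' Gs (mi1 GI')); rewrite (iso1 qiso' (mi1 GI')).
have N'0 : {ae mu, forall x, N' x -> set0 x}.
  apply: (support_match_mono HI' qiso' mN' measurable0 NN s0).
  by apply: filterS ((ae_measure0 mu mN).2 N0).
apply: filterS2 (fP N N' mN mN' NN) N'0 => x NE N'x.
by apply: contrapT => /PN/NE/N'x.
Qed.

(** An abstract isomorphism between groups with many involutions is the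
    conjugation by an automorphism: it is implemented by a non-singular map, and
    the image of the measure under that map is invariant and absolutely
    continuous, hence equal to [mu] by ergodicity. *)
Theorem reconstruction (T : aut mu) : G T -> ergodic T ->
  exists S : aut mu, forall U, G U -> q U = (S * U * S^-1)%g.
Proof.
move=> GT ergT.
have GM := miM GI; have GV := miV GI; have G1 := mi1 GI.
have [p [piso pq qp]] := iso_inverse GM qiso.
have [f mf fP] := support_match_realized QS GI HI qiso.
have [g mg gP] := support_match_realized QS HI GI piso.
have fnull := match_map_null GI HI qiso mf fP.
have gnull := match_map_null HI GI piso mg gP.
have matchV A A' : support_match G q A A' -> support_match H p A' A.
  move=> AA s Hs; have [t Gt <-] := iso_surj qiso Hs.
  by rewrite pq//; split=> /(AA t Gt).
have fg : {ae mu, forall x, f (g x) = x}.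
  apply: (ae_eq_fun QS) => A mA.
  have [A' [mA' AA]] := support_match_exists QS GI HI qiso mA.
  by apply: filterS2 (gnull _ (fP A A' mA mA' AA)) (gP A' A mA' mA (matchV _ _ AA))
    => x -> ->.
have gf : {ae mu, forall x, g (f x) = x}.
  apply: (ae_eq_fun QS) => A mA.
  have [A' [mA' AA]] := support_match_exists QS HI GI piso mA.
  have AA' : support_match G q A' A.
    by move=> s Gs; have := AA (q s) (iso_in qiso Gs); rewrite pq// => ->.
  by apply: filterS2 (fnull _ (gP A A' mA mA' AA)) (fP A' A mA' mA AA') => x -> ->.
have equiv U : G U -> {ae mu, forall x, U (f x) = f (q U x)}.
  move=> GU; apply: (ae_eq_fun QS) => A mA.
  have [A' [mA' AA]] := support_match_exists QS GI HI qiso mA.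
  have UA := support_match_preimage GI qiso GU AA.
  apply: filterS2 (fP _ _ (mp_preimage_measurable U mA)
    (mp_preimage_measurable (q U) mA') UA) (ae_mp_comp (q U) (fP A A' mA mA' AA)).
  by move=> x Ux ->.
pose nu := distribution mu (mfun_Sub (mem_set mf)).
have nuE A : nu A = mu (f @^-1` A) by [].
have muf A : measurable A -> mu (f @^-1` A) = mu A.
  move=> mA; rewrite -nuE.
  have mfA B : measurable B -> measurable (f @^-1` B) by exact: measurable_preimage.
  apply: (ergodic_invariant_measure ergT) => // B mB.
    have mTB := mp_preimage_measurable T mB.
    suff : mu (f @^-1` (T @^-1` B)) = mu (f @^-1` B) by [].
    rewrite -[RHS](mp_preimageE (q T)); last exact: mfA.
    apply: measure_eq_ae; first exact: mfA.
      by apply: mp_preimage_measurable; exact: mfA.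
    by apply: filterS (equiv T GT) => x; rewrite /preimage /= => ->.
  move=> B0; suff : mu (f @^-1` B) = 0%E by [].
  apply/(ae_measure0 mu (mfA _ mB)).
  by apply: (fnull (fun x => ~ B x)); exact/(ae_measure0 mu mB).
have mug A : measurable A -> mu (g @^-1` A) = mu A.
  move=> mA; have mgA := measurable_preimage mg mA.
  rewrite -(muf _ mgA); apply: measure_eq_ae => //; first exact: measurable_preimage.
  by apply: filterS gf => x; rewrite /preimage /= => ->.
have [s sE] := mp_bij_of_ae_inverse QS mf mg muf mug gf fg.
exists ((aut_of s)^-1)%g => U GU.
suff sU : (aut_of s * q U = U * aut_of s)%g.
  by rewrite invgK -mulgA -sU mulgA mulVg mul1g.
have aE : {ae mu, forall x, aut_of s x = f x}.
  by apply: filterS2 (aut_ofE s) sE => x ->.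
apply/aut_eqP.
apply: filterS3 (filterI (aut_mul_ae (aut_of s) (q U)) (aut_mul_ae U (aut_of s)))
  (equiv U GU) (filterI aE (ae_mp_comp (q U) aE)) => x.
by move=> [-> ->] E [-> ->].
Qed.

End reconstruction.

(** * Bijections of the integers *)

Section integer_bijections.
Variables (w v : int -> int).
Hypotheses (wK : cancel w v) (vK : cancel v w).

Lemma near_neq (s : int -> int) (c : int) : injective s ->
  \forall L \near \oo, w (s (Posz L)) != c.
Proof.
move=> sI; have [[L0 L0c]|nL] := pselect (exists L : nat, w (s L) = c); last first.
  by apply: nearW => L; apply/eqP => Lc; apply: nL; exists L.
exists L0.+1 => //= L /= L0L; apply/eqP; rewrite -L0c => /(can_inj wK)/sI[LL0].
by rewrite LL0 ltnn in L0L.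
Qed.

Lemma near_out (s : int -> int) (B : nat) : injective s ->
  \forall L \near \oo, B%:Z <= `|w (s (Posz L))|.
Proof.
move=> sI; elim: B => [|B IH]; first by apply: nearW => L.
have n1 := near_neq (Posz B) sI; have n2 := near_neq (- Posz B) sI.
by apply: filterS3 IH n1 n2 => L; lia.
Qed.

Lemma oppZ_inj : injective (fun k : int => - k). Proof. exact: oppr_inj. Qed.

Lemma idZ_inj : injective (fun k : int => k). Proof. by []. Qed.

Lemma near_ge (c : int) : (\forall L \near \oo, 0 <= w (Posz L)) ->
  \forall L \near \oo, c <= w (Posz L).
Proof.
move=> w0; have wc := near_out `|c|%N idZ_inj.
by apply: filterS2 w0 wc => L /=; lia.
Qed.

Lemma near_lt (c : int) : (\forall L \near \oo, w (- Posz L) < 0) ->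
  \forall L \near \oo, w (- Posz L) < c.
Proof.
move=> w0; have wc := near_out (`|c|%N).+1 oppZ_inj.
by apply: filterS2 w0 wc => L /=; lia.
Qed.

Lemma bounded_window (K : nat) : exists B : nat, forall k : int, `|k| < K%:Z ->
  `|w k| <= B%:Z.
Proof.
elim: K => [|K [B IH]]; first by exists 0%N => k; lia.
exists (B + `|w K|%N + `|w (- K%:Z)|%N)%N => k kK.
have [kK'|] := ltP `|k| K%:Z; first by have := IH k kK'; lia.
move=> Kk; have [->|->] : k = K \/ k = - K%:Z by lia.
  by lia.
by lia.
Qed.

(** A bijection of the integers with finitely many crossings of the origin
    goes from one end to the other one: both ends being sent to the same end
    would leave only finitely many values for the opposite side. *)
Lemma end_to_end (M : nat) :
  (forall k, (M%:Z <= w k -> 0 <= w (k + 1)) /\ (w k < - M%:Z -> w (k + 1) < 0)) ->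
  ((\forall L \near \oo, 0 <= w (Posz L)) /\ (\forall L \near \oo, w (- Posz L) < 0)) \/
  ((\forall L \near \oo, w (Posz L) < 0) /\ (\forall L \near \oo, 0 <= w (- Posz L))).
Proof.
move=> cross.
have [K1 _ K1P] := near_out M.+1 idZ_inj; have [K2 _ K2P] := near_out M.+1 oppZ_inj.
pose K := maxn K1 K2.
have outp (L : nat) : (K <= L)%N -> M.+1%:Z <= `|w L| by move=> KL; have := K1P L; apply; rewrite /=; lia.
have outn (L : nat) : (K <= L)%N -> M.+1%:Z <= `|w (- L%:Z)| by move=> KL; have := K2P L; apply; rewrite /=; lia.
have stepp (i : nat) : (0 <= w (K + i)%N) = (0 <= w K).
  elim: i => [|i <-]; first by rewrite addn0.
  have := outp (K + i)%N (leq_addr _ _); have := cross (K + i)%N.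
  rewrite (_ : (K + i)%N%:Z + 1 = (K + i.+1)%N%:Z); last by lia.
  move=> [c1 c2] o; apply/idP/idP => h; last by apply: c1; lia.
  by rewrite leNgt; apply/negP => h'; have := c2; lia.
have stepn (i : nat) : (0 <= w (- (K + i)%N%:Z)) = (0 <= w (- K%:Z)).
  elim: i => [|i <-]; first by rewrite addn0.
  have := outn (K + i.+1)%N (leq_addr _ _); have := cross (- (K + i.+1)%N%:Z).
  rewrite (_ : - (K + i.+1)%N%:Z + 1 = - (K + i)%N%:Z); last by lia.
  move=> [c1 c2] o; apply/idP/idP => h; first by apply: c1; lia.
  by rewrite leNgt; apply/negP => h'; have := c2; lia.
have signp (L : nat) : (K <= L)%N -> (0 <= w L) = (0 <= w K).
  by move=> KL; rewrite -(stepp (L - K)%N) subnKC.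
have signn (L : nat) : (K <= L)%N -> (0 <= w (- L%:Z)) = (0 <= w (- K%:Z)).
  by move=> KL; rewrite -(stepn (L - K)%N) subnKC.
have [B BP] := bounded_window K.
have [p0|p0] := leP 0 (w K); have [n0|n0] := leP 0 (w (- K%:Z)).
- exfalso; have wv := vK (- B.+1%:Z).
  have [kK|kK] := ltP `|v (- B.+1%:Z)| K%:Z; first by have := BP _ kK; rewrite wv; lia.
  have [vp|vn] := leP 0 (v (- B.+1%:Z)).
    by have := signp `|v (- B.+1%:Z)|%N; rewrite gez0_abs// wv; lia.
  by have := signn `|v (- B.+1%:Z)|%N; rewrite ltz0_abs// opprK wv; lia.
- left; split; exists K => //= L /= KL; first by rewrite signp.
  by rewrite ltNge signn// -ltNge.
- right; split; exists K => //= L /= KL; last by rewrite signn.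
  by rewrite ltNge signp// -ltNge.
- exfalso; have wv := vK B.+1%:Z.
  have [kK|kK] := ltP `|v B.+1%:Z| K%:Z; first by have := BP _ kK; rewrite wv; lia.
  have [vp|vn] := leP 0 (v B.+1%:Z).
    by have := signp `|v B.+1%:Z|%N; rewrite gez0_abs// wv; lia.
  by have := signn `|v B.+1%:Z|%N; rewrite ltz0_abs// opprK wv; lia.
Qed.

Definition window (c : int) (L : nat) : nat :=
  (\sum_(0 <= i < L.*2) (c <= w (i%:Z - L%:Z))%R)%N.

(** Only the place [v c] counts on the left and not on the right. *)
Lemma windowS (c : int) :
  \forall L \near \oo, window c L = (window (c + 1) L).+1.
Proof.
exists (`|v c|%N).+1 => //= L /= Lc; rewrite /window.
have -> : (\sum_(0 <= i < L.*2) (c <= w (i%:Z - L%:Z))%R =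
    \sum_(0 <= i < L.*2) (c + 1 <= w (i%:Z - L%:Z))%R +
    \sum_(0 <= i < L.*2) (i == `|(v c + L%:Z)%R|%N))%N.
  rewrite -big_split /=; apply: eq_bigr => i _.
  have -> : (i == `|(v c + L%:Z)%R|%N) = (w (i%:Z - L%:Z) == c).
    apply/eqP/eqP => [->|<-]; last by rewrite wK; lia.
    rewrite -[RHS]vK; congr (w _); lia.
  by have := lerP c (w (i%:Z - L%:Z)); lia.
rewrite -addn1; congr addn.
have vcL : (`|(v c + L%:Z)%R| < L.*2)%N by lia.
rewrite big_mkord (bigD1 (Ordinal vcL))//= eqxx big1 ?addn0// => i.
by rewrite -val_eqE /= => /negPf ->.
Qed.

Lemma window_shift (c : int) (n : nat) :
  \forall L \near \oo, window c L = (window (c + n%:Z) L + n)%N.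
Proof.
elim: n => [|n IH]; first by apply: nearW => L; rewrite addr0 addn0.
apply: filterS2 IH (windowS (c + n%:Z)) => L -> ->.
by rewrite -addrA -PoszD addn1 addSnnS.
Qed.

(** As [w] is a bijection, each unit step of the origin gains or loses exactly one
    place. *)
Lemma window_translate (c : int) :
  \forall L \near \oo, (window 0 L)%:Z = (window c L)%:Z + c.
Proof.
case: c => n.
  by apply: filterS (window_shift 0 n) => L ->; rewrite add0r PoszD.
apply: filterS (window_shift (Negz n) n.+1) => L ->.
by rewrite NegzE addNr PoszD addrK.
Qed.

(** [L] is the number of non-negative places in the window, so this is the
    number of non-negative places with a negative value minus the number of
    negative places with a non-negative value. *)
Definition defect (L : nat) : int := L%:Z - (window 0 L)%:Z.

Hypothesis w_up : \forall L \near \oo, 0 <= w (Posz L).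
Hypothesis w_down : \forall L \near \oo, w (- Posz L) < 0.

Lemma defect_stable : \forall L \near \oo, defect L.+1 = defect L.
Proof.
have w_down' : \forall L \near \oo, w (- Posz L.+1) < 0.
  by have [N _ NP] := w_down; exists N => // L NL; apply: NP => /=; rewrite leqW.
apply: filterS2 w_up w_down' => L up down; rewrite /defect /window doubleS.
rewrite big_nat_recl// big_nat_recr//=.
have -> : (0 <= w (0%:Z - L.+1%:Z)) = false.
  by rewrite sub0r; apply/negbTE; rewrite -ltNge.
have -> : (0 <= w (L.*2.+1%:Z - L.+1%:Z)) = true.
  by rewrite (_ : L.*2.+1%:Z - L.+1%:Z = L%:Z)//; lia.
have -> : (\sum_(0 <= i < L.*2) (0 <= w (i.+1%:Z - L.+1%:Z))%R =
    \sum_(0 <= i < L.*2) (0 <= w (i%:Z - L%:Z))%R)%N.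
  by apply: eq_bigr => i _; congr (nat_of_bool (0 <= w _)); lia.
by rewrite add0n addn1; set s := (\sum_(_ <= _ < _) _)%N; lia.
Qed.

Lemma defect_limit : exists m : int, \forall L \near \oo, defect L = m.
Proof.
have [K _ KP] := defect_stable; exists (defect K); exists K => // L /= KL.
rewrite -(subnKC KL); elim: (L - K)%N => [|i <-]; first by rewrite addn0.
by rewrite addnS; apply: KP => /=; rewrite leq_addr.
Qed.

End integer_bijections.

(** Reading the bijection from the next point of its cycle moves the
    separation of indices by one and the origin of the values by [w 1]; the two
    effects on the defect add up. *)
Lemma defect_shift (w v : int -> int) (wK : cancel w v) (vK : cancel v w) :
  (\forall L \near \oo, 0 <= w (Posz L)) ->
  (\forall L \near \oo, w (- Posz L) < 0) ->
  \forall L \near \oo,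
    defect (fun k => w (k + 1) - w 1) L = defect w L + w 1 - 1.
Proof.
move=> up down.
apply: filterS3 (near_ge wK (w 1) up) (near_lt wK (w 1) down)
  (window_translate wK vK (w 1)) => L wL wNL; rewrite /defect => ->.
have -> : window (fun k => w (k + 1) - w 1) 0 L = (window w (w 1) L).+1.
  rewrite /window.
  have -> : (\sum_(0 <= i < L.*2) (0 <= w (i%:Z - L%:Z + 1) - w 1)%R =
      \sum_(0 <= i < L.*2) (w 1 <= w (i.+1%:Z - L%:Z))%R)%N.
    apply: eq_bigr => i _; rewrite subr_ge0; congr (nat_of_bool (_ <= w _)); lia.
  have := @big_nat_recl _ 0%N addn L.*2 0%N (fun i => nat_of_bool (w 1 <= w (i%:Z - L%:Z))) isT.
  rewrite big_nat_recr//= sub0r.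
  rewrite (_ : (w 1 <= w (- L%:Z)) = false) ?add0n; last by apply/negbTE; rewrite -ltNge.
  rewrite (_ : L.*2%:Z - L%:Z = L%:Z); last by lia.
  by rewrite wL addn1 => ->.
lia.
Qed.

(** * Interleaved orbits *)

Section invariant_core.
Context (R : realType) d (X : measurableType d) (mu : probability X R).

(** Removing the orbit of a null set turns almost sure properties into properties
    holding everywhere on an exactly invariant conull set, where orbits can be
    handled pointwise. *)
Lemma invariant_core (t : mp_bij mu) (P : X -> Prop) : {ae mu, forall x, P x} ->
  exists X0 : set X, [/\ measurable X0, {ae mu, forall x, X0 x},
    (forall x n, X0 x -> X0 (mp_pow t n x)) & (forall x, X0 x -> P x)].
Proof.
move=> [N [mN N0 NP]].
exists [set x | forall n, ~ N (mp_pow t n x)]; split.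
- apply: measurable_forall_count => n.
  by apply: (measurableC (A := mp_pow t n @^-1` N)); exact: mp_preimage_measurable.
- by apply: (ae_orbit t (P := fun x => ~ N x)); exact/(ae_measure0 mu mN).
- by move=> x n Xx m; rewrite -mp_powD; exact: Xx.
- by move=> x Xx; apply: contrapT => /NP; exact: (Xx 0).
Qed.

End invariant_core.

Section interleaving.
Context (R : realType) d (X : measurableType d) (mu : probability X R).
Implicit Types (t u : mp_bij mu) (x : X).

(** Freeness is included so that points of an orbit have well-defined integer
    indices for both transformations. *)
Record same_orbit t u x : Prop := SameOrbit {
  so_freet : forall n, mp_pow t n x = x -> n = 0;
  so_freeu : forall n, mp_pow u n x = x -> n = 0;
  so_in : forall k, exists n, mp_pow u k x = mp_pow t n x;
  so_onto : forall n, exists k, mp_pow t n x = mp_pow u k x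
}.

Lemma so_index t u x : same_orbit t u x -> exists w v : int -> int,
  [/\ cancel w v, cancel v w & forall k, mp_pow u k x = mp_pow t (w k) x].
Proof.
move=> [ft fu /choice[w wP] /choice[v vP]]; exists w, v; split => // k.
  by apply: (mp_pow_inj fu); rewrite -vP -wP.
by apply: (mp_pow_inj ft); rewrite -wP -vP.
Qed.

Definition after t u (k : int) x := exists n : nat, mp_pow u k x = mp_pow t n x.

Lemma afterE t u x (w : int -> int) k : (forall n, mp_pow t n x = x -> n = 0) ->
  (forall k, mp_pow u k x = mp_pow t (w k) x) -> after t u k x <-> 0 <= w k.
Proof.
move=> ft wP; rewrite /after wP; split=> [[n /(mp_pow_inj ft) ->//]|].
by case: (w k) => // n _; exists n.
Qed.

Definition forward t u x :=
  (\forall L \near \oo, after t u (Posz L) x) /\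
  (\forall L \near \oo, ~ after t u (- Posz L) x).

(** Counted over the window from [-L] to [L - 1]: the number of points of the
    forward [u]-orbit of [x] outside of its forward [t]-orbit, minus the number of
    points of the latter outside of the former. *)
Definition orbit_defect t u (L : nat) x : int :=
  L%:Z - (\sum_(0 <= i < L.*2) `[< after t u (i%:Z - L%:Z) x >] : nat)%N%:Z.

Lemma orbit_defectE t u x (w : int -> int) L : (forall n, mp_pow t n x = x -> n = 0) ->
  (forall k, mp_pow u k x = mp_pow t (w k) x) -> orbit_defect t u L x = defect w L.
Proof.
move=> ft wP; rewrite /orbit_defect /defect /window; congr (_ - Posz _).
apply: eq_bigr => i _; congr nat_of_bool; apply/asboolP/idP => /(afterE _ ft wP) //.
Qed.

Variables (Q : nat -> nat -> set X) (QS : ball_scheme Q).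

Lemma measurable_after t u k : measurable [set x | after t u k x].
Proof.
by apply: measurable_ex_count => n; apply: (measurable_eq_fun QS); exact: measurable_mp_fun.
Qed.

Lemma measurable_orbit_defect t u L : levels_measurable (orbit_defect t u L).
Proof.
move=> m; rewrite /orbit_defect.
have H n : levels_measurable (fun x =>
    (\sum_(0 <= i < n) `[< after t u (i%:Z - L%:Z) x >] : nat)%N).
  elim: n => [|n IH].
    under eq_fun do rewrite big_nil; exact: levels_measurable_cst.
  under eq_fun do rewrite big_nat_recr//=.
  exact: (measurable_levels_comp (fun i : nat * bool => (i.1 + i.2)%N)
    (measurable_levels_pair IH (levels_asbool (measurable_after t u (n%:Z - L%:Z))))).
exact: (measurable_levels_comp (fun n : nat => L%:Z - n%:Z) (H L.*2)).
Qed.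

Definition orbit_defect_limit t u x m :=
  exists K : nat, forall L : nat, (K <= L)%N -> orbit_defect t u L x = m.

(** Send [x] to the point of its [t]-orbit whose forward [t]-orbit and the
    forward [u]-orbit of [x] differ by equally many points on both sides. Passing
    from [x] to [u x] removes one point from the latter, so it moves this
    balancing point by one step of [t]. As the map permutes orbits by powers
    of [t], it preserves the measure. *)
Lemma interleaved_conjugate t u :
  {ae mu, forall x, same_orbit t u x /\ forward t u x} ->
  exists s : mp_bij mu, {ae mu, forall x, s (u x) = t (s x)}.
Proof.
move=> /(invariant_core t)[X0 [mX0 aeX0 X0t X0P]].
have near_lim x m : orbit_defect_limit t u x m <->
    \forall L \near \oo, orbit_defect t u L x = m.
  by split=> [[K KP]|[K _ KP]]; exists K.
have lim_uniq x m m' : orbit_defect_limit t u x m -> orbit_defect_limit t u x m' -> m = m'.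
  move=> [K KP] [K' KP']; rewrite -(KP (maxn K K')) ?leq_maxl//.
  by rewrite (KP' (maxn K K')) ?leq_maxr.
have index x : X0 x -> exists w v : int -> int,
    [/\ cancel w v, cancel v w, forall k, mp_pow u k x = mp_pow t (w k) x,
        (\forall L \near \oo, 0 <= w (Posz L)) &
        (\forall L \near \oo, w (- Posz L) < 0)].
  move=> /X0P[so [up down]]; have [w [v [wK vK wP]]] := so_index so.
  have ft := so_freet so; exists w, v; split => //.
    by apply: filterS up => L /(afterE _ ft wP).
  by apply: filterS down => L nL; rewrite ltNge; apply/negP => /(afterE _ ft wP).
have free x : X0 x -> forall n, mp_pow t n x = x -> n = 0.
  by move=> /X0P[[]].
have limE x : X0 x -> exists m, orbit_defect_limit t u x m.
  move=> Xx; have [w [v [wK vK wP up down]]] := index x Xx.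
  have [m mP] := defect_limit up down.
  exists m; apply/near_lim; apply: filterS mP => L <-.
  exact: orbit_defectE (free x Xx) wP.
have X0u x : X0 x -> X0 (u x).
  move=> Xx; have [n un] := so_in (X0P x Xx).1 1.
  by rewrite -[u x]mp_pow1 un; exact: X0t.
have X0pow x k : X0 x -> X0 (mp_pow u k x).
  by move=> Xx; have [n ->] := so_in (X0P x Xx).1 k; exact: X0t.
pose tau x := xget 0 [set m | orbit_defect_limit t u x m].
have tauE x m : X0 x -> tau x = m <-> orbit_defect_limit t u x m.
  move=> /limE[l lP]; have tauP : orbit_defect_limit t u x (tau x).
    exact: (xgetPex 0 (P := [set m | orbit_defect_limit t u x m])) (ex_intro _ l lP).
  by split=> [<-//|]; exact: lim_uniq.
(* advancing by [u] changes the defect by [w 1 - 1], so the point that balances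
   [u x] is the [t]-successor of the one that balances [x] *)
have step x : X0 x -> mp_pow t (- tau (u x)) (u x) = t (mp_pow t (- tau x) x).
  move=> Xx; have [w [v [wK vK wP up down]]] := index x Xx.
  suff -> : tau (u x) = tau x + w 1 - 1.
    rewrite -[u x]mp_pow1 wP -mp_powD -mp_powS; congr (mp_pow _ _ _); lia.
  apply/(tauE _ _ (X0u _ Xx))/near_lim.
  have /near_lim xlim : orbit_defect_limit t u x (tau x) by exact/tauE.
  apply: filterS2 xlim (defect_shift wK vK up down) => L <-.
  rewrite (orbit_defectE L (free x Xx) wP) => <-.
  apply: orbit_defectE (free _ (X0u _ Xx)) _ => k.
  rewrite -{1}[u x]mp_pow1 -mp_powD wP -[u x]mp_pow1 wP -mp_powD.
  by congr (mp_pow _ _ _); lia.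
pose c x : int := if `[< X0 x >] then - tau x else 0.
pose f x := mp_pow t (c x) x.
have fE x : X0 x -> f x = mp_pow t (- tau x) x by move=> Xx; rewrite /f /c asboolT.
have fN x : ~ X0 x -> f x = x by move=> nXx; rewrite /f /c asboolF.
have X0f x : X0 (f x) <-> X0 x.
  split=> [fx|Xx]; last exact: X0t.
  by apply: contrapT => nXx; apply: (nXx); rewrite -(fN _ nXx).
have fpow x k : X0 x -> f (mp_pow u k x) = mp_pow t k (f x).
  move=> Xx; elim: k => [|k IH|k IH] //.
    have Xk := X0pow x k Xx.
    by rewrite intS addrC !mp_powS (fE _ (X0u _ Xk)) step// -fE// IH.
  have -> : - k.+1%:Z = - k%:Z - 1 by lia.
  rewrite [in RHS]mp_powB1 -IH; apply: (can_inj (mp_funK t)); rewrite mp_invK.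
  have Xk := X0pow x (- k%:Z - 1) Xx.
  have -> : mp_pow u (- k%:Z) x = u (mp_pow u (- k%:Z - 1) x).
    by rewrite -mp_powS subrK.
  by rewrite [RHS](fE _ (X0u _ Xk)) step// -fE.
have mc : levels_measurable c.
  move=> n.
  rewrite (_ : [set _ | _] = (X0 `&` [set x | orbit_defect_limit t u x (- n)])
      `|` (~` X0 `&` [set x | 0 = n])).
    apply: measurableU; apply: measurableI => //.
    - apply: measurable_ex_count => K; apply: measurable_forall_count => L.
      have [KL|nKL] := boolP (K <= L)%N; last by rewrite (_ : [set _ | _] = setT)// -subTset.
      rewrite (_ : [set _ | _] = [set x | orbit_defect t u L x = - n]).
        exact: measurable_orbit_defect.
      by apply/seteqP; split => x /=; [apply|].
    - exact: measurableC.
    - exact: (levels_measurable_cst X 0 n).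
  apply/seteqP; split => x /=; rewrite /c; case: asboolP => Xx.
  - by move=> <-; left; split => //; rewrite opprK; apply/tauE.
  - by move=> <-; right.
  - by case=> [[_ /(tauE x _ Xx) ->]|[]//]; rewrite opprK.
  - by case=> [[]|[]].
have [|y|s sE] := mp_piecewise (h := mp_pow t) mc.
- move=> x y; rewrite -/(f x) -/(f y) => fxy.
  have [Xx|nXx] := pselect (X0 x); last first.
    have nXy : ~ X0 y by move=> /X0f; rewrite -fxy => /X0f.
    by rewrite -(fN _ nXx) -(fN _ nXy).
  have Xy : X0 y by apply/X0f; rewrite -fxy; apply/X0f.
  have [k yk] : exists k, y = mp_pow u k x.
    have [k kP] := so_onto (X0P x Xx).1 (tau y - tau x).
    exists k; rewrite -kP mp_powD; move: fxy; rewrite !fE// => ->.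
    by rewrite mp_powNK.
  have : mp_pow t k (f x) = f x by rewrite -fpow// -yk fxy.
  by move=> /(free _ ((X0f x).2 Xx)) k0; rewrite yk k0.
- have [Xy|nXy] := pselect (X0 y); last by exists y; exact: fN.
  exists (mp_pow u (tau y) y).
  by rewrite -/(f _) fpow// fE// mp_powNK.
exists s; apply: filterS aeX0 => x Xx.
by rewrite !sE -/(f _) -/(f x) (fE _ (X0u _ Xx)) step// -fE.
Qed.

End interleaving.

(** * Same orbits with an integrable cocycle *)

Section belinskaya.
Context (R : realType) d (X : measurableType d) (mu : probability X R).
Variables (Q : nat -> nat -> set X) (QS : ball_scheme Q).
Implicit Types (t u : mp_bij mu) (c : X -> int) (x : X).

Lemma ae_orbit_sub t u : {ae mu, forall x, exists n, u x = mp_pow t n x} ->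
  {ae mu, forall x, forall k, exists n, mp_pow u k x = mp_pow t n x}.
Proof.
move=> ut; have ut' : {ae mu, forall x, exists n, mp_inv u x = mp_pow t n x}.
  apply: filterS (ae_mp_comp (mp_opp u) ut) => x [n /=].
  by rewrite mp_invK => xn; exists (- n); rewrite [in RHS]xn mp_powK.
apply: filterS2 (ae_orbit t ut) (ae_orbit t ut') => x tx tx'.
elim=> [|k [n kn]|k [n kn]]; first by exists 0.
  have [m mP] := tx n; exists (m + n).
  by rewrite intS addrC mp_powS kn mP -mp_powD.
have [m mP] := tx' n; exists (m + n).
have -> : - k.+1%:Z = - k%:Z - 1 by lia.
by rewrite mp_powB1 kn mP -mp_powD.
Qed.

Let big_jump c (m : nat) := [set x | (m < `|c x|)%N].

Lemma sum_ltn_le (n k : nat) : (\sum_(0 <= m < n) (m < k) <= k)%N.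
Proof.
have -> : (\sum_(0 <= m < n) (m < k) = minn n k)%N.
  elim: n => [|n IH]; first by rewrite big_nil min0n.
  by rewrite big_nat_recr//= IH; lia.
exact: geq_minr.
Qed.

Lemma measurable_big_jump c m : levels_measurable c -> measurable (big_jump c m).
Proof. by move=> mc; exact: (measurable_levels [set k : int | (m < `|k|)%N] mc). Qed.

Lemma sum_big_jump c : levels_measurable c ->
  (\sum_(0 <= m <oo) mu (big_jump c m) <= int_norm1 mu c)%E.
Proof.
move=> mc; have mJ m := measurable_big_jump m mc.
have mI m : measurable_fun setT (fun x => (\1_(big_jump c m) x : R)%:E).
  suff : measurable_fun setT (EFin \o (\1_(big_jump c m) : X -> R)) by [].
  by apply/measurable_EFinP; exact: measurable_indic.
apply: lime_le; first by apply: is_cvg_nneseries => *; exact: measure_ge0.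
apply: nearW => n.
have -> : (\sum_(0 <= m < n) mu (big_jump c m) =
    \int[mu]_x \sum_(0 <= m < n) (\1_(big_jump c m) x)%:E)%E.
  rewrite ge0_integral_sum//.
  by apply: eq_bigr => m _; rewrite integral_indic// setIT.
apply: ge0_le_integral => //.
- by move=> x _; apply: sume_ge0 => m _; rewrite lee_fin.
- exact: emeasurable_sum.
- exact: measurable_int_norm.
- move=> x _; rewrite sumEFin lee_fin.
  have -> : `|(c x)%:~R| = `|c x|%N%:R :> R by rewrite -intr_norm -abszE.
  have -> : \sum_(0 <= m < n) \1_(big_jump c m) x =
      (\sum_(0 <= m < n) (m < `|c x|)%N)%N%:R :> R.
    rewrite natr_sum; apply: eq_bigr => m _; rewrite indicE; congr (nat_of_bool _)%:R.
    by apply/idP/idP; rewrite inE.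
  by rewrite ler_nat sum_ltn_le.
Qed.

(** By Borel-Cantelli, an integrable cocycle grows at most linearly along
    almost every orbit: only finitely many arrows cross the origin. *)
Lemma cocycle_sublinear t c : levels_measurable c -> (int_norm1 mu c < +oo)%E ->
  {ae mu, forall x, exists M : nat, forall m : nat, (M <= m)%N ->
    `|c (mp_pow t m x)| <= m%:Z /\ `|c (mp_pow t (- m.+1%:Z) x)| <= m%:Z}.
Proof.
move=> mc Lc; have mJ m := measurable_big_jump m mc.
have BC (h : nat -> int) : {ae mu, forall x, exists M : nat, forall m : nat,
    (M <= m)%N -> ~ big_jump c m (mp_pow t (h m) x)}.
  pose F m := mp_pow t (h m) @^-1` big_jump c m.
  have mF m : measurable (F m) by exact: mp_preimage_measurable.
  have sF : (\sum_(0 <= m <oo) mu (F m) < +oo)%E.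
    apply: le_lt_trans Lc; apply: le_trans (sum_big_jump mc).
    by apply: lee_nneseries => [m _ _|m _]; rewrite ?measure_ge0// /F mp_preimageE.
  have mL : measurable (lim_sup_set F).
    by apply: bigcapT_measurable => n; apply: bigcup_measurable => k _.
  have /(ae_measure0 mu mL) := lim_sup_set_cvg0 mF sF.
  apply: filterS => x nL; apply: contrapT => nM; apply: nL => n _.
  apply: contrapT => nF; apply: nM; exists n => m nm mF'; apply: nF; by exists m.
apply: filterS2 (BC Posz) (BC (fun m => - m.+1%:Z)) => x [M MP] [M' MP'].
exists (maxn M M') => m; rewrite geq_max => /andP[Mm Mm'].
by have := MP m Mm; have := MP' m Mm'; rewrite /big_jump /=; lia.
Qed.

Lemma same_orbit_opp t u x : same_orbit t u x -> same_orbit t (mp_opp u) x.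
Proof.
case=> ft fu ui uo; split => // [n|k|n].
- by rewrite mp_powV => /fu; lia.
- by rewrite mp_powV; exact: ui.
- by have [k kP] := uo n; exists (- k); rewrite mp_powV opprK.
Qed.

(** Sublinear growth of the cocycle forbids crossing the origin from far away. *)
Lemma forward_or_backward t u c x : same_orbit t u x ->
  (forall n, u (mp_pow t n x) = mp_pow t (c (mp_pow t n x)) (mp_pow t n x)) ->
  (exists M : nat, forall m : nat, (M <= m)%N ->
    `|c (mp_pow t m x)| <= m%:Z /\ `|c (mp_pow t (- m.+1%:Z) x)| <= m%:Z) ->
  forward t u x \/ forward t (mp_opp u) x.
Proof.
move=> so uc [M MP]; have [w [v [wK vK wP]]] := so_index so.
have ft := so_freet so.
have wS k : w (k + 1) = c (mp_pow t (w k) x) + w k.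
  by apply: (mp_pow_inj ft); rewrite -wP mp_powS wP uc -mp_powD.
have wP' k : mp_pow (mp_opp u) k x = mp_pow t (w (- k)) x by rewrite mp_powV wP.
have aft k := afterE k ft wP.
have aft' k := @afterE _ _ _ _ t (mp_opp u) x (fun k => w (- k)) k ft wP'.
have [|[up down]|[up down]] := end_to_end (M := M) wK vK.
- move=> k; rewrite wS; split => h.
    have [m mE] : exists m : nat, w k = m by exists `|w k|%N; lia.
    by rewrite mE; have [|] := MP m; lia.
  have [m mE] : exists m : nat, w k = - m.+1%:Z by exists `|w k|%N.-1; lia.
  by rewrite mE; have [|] := MP m; lia.
- left; split; first by apply: filterS up => L /aft.
  by apply: filterS down => L wL /aft; lia.
- right; split; first by apply: filterS down => L wL; apply/aft'.
  by apply: filterS up => L wL /aft'; rewrite opprK; lia.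
Qed.

(** A quantitative form of being sent to the positive end, which is visibly
    independent of the chosen point of the orbit. *)
Definition drifts_up t u x := forall a : nat, exists K : nat, forall L : nat,
  (K <= L)%N -> exists n : nat, mp_pow u L x = mp_pow t (n + a)%N x.

Lemma measurable_drifts_up t u : measurable [set x | drifts_up t u x].
Proof.
apply: measurable_forall_count => a; apply: measurable_ex_count => K.
apply: measurable_forall_count => L.
have [KL|nKL] := boolP (K <= L)%N; last by rewrite (_ : [set _ | _] = setT)// -subTset.
rewrite (_ : [set _ | _] = [set x | exists n : nat, mp_pow u L x = mp_pow t (n + a)%N x]).
  apply: measurable_ex_count => n; apply: (measurable_eq_fun QS); exact: measurable_mp_fun.
by apply/seteqP; split => x /=; [apply|].
Qed.

Lemma forward_drifts_up t u x : same_orbit t u x -> forward t u x -> drifts_up t u x.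
Proof.
move=> so [up _] a; have [w [v [wK _ wP]]] := so_index so.
have ft := so_freet so.
have wup : \forall L \near \oo, 0 <= w (Posz L).
  by apply: filterS up => L /(afterE L ft wP).
have [K _ KP] := near_ge wK a wup; exists K => L KL.
have := KP L KL; rewrite /= => aL; exists `|w L - a%:Z|%N.
by rewrite wP; congr (mp_pow _ _ _); lia.
Qed.

Lemma drifts_up_forward t u x :
  forward t u x \/ forward t (mp_opp u) x -> drifts_up t u x -> forward t u x.
Proof.
case=> // -[_ [K' _ down]] /(_ 0%N)[K KP]; exfalso.
have [n nP] := KP (maxn K K') (leq_maxl _ _).
apply: (down (maxn K K')); first by rewrite /= leq_maxr.
by exists n; rewrite mp_powV opprK nP addn0.
Qed.

Lemma drifts_up_orbit t u x m : same_orbit t u x -> drifts_up t u x ->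
  drifts_up t u (mp_pow t m x).
Proof.
move=> so dx a; have [j jP] := so_onto so m.
have [K KP] := dx (a + `|m|)%N; exists (K + `|j|)%N => L KL.
have [n nP] := KP `|(L%:Z + j)%R|%N ltac:(lia).
exists `|((n + (a + `|m|))%N%:Z - m - a%:Z)%R|%N.
rewrite {1}jP -mp_powD (_ : L%:Z + j = `|(L%:Z + j)%R|%N); last by lia.
by rewrite nP -mp_powD; congr (mp_pow _ _ _); lia.
Qed.

(** Belinskaya's theorem, by an argument due to Katznelson. The indices along the
    [T]-orbit of the successive points of a [U]-orbit form a bijection of the
    integers, with finitely many crossings of the origin since the cocycle is
    integrable. So forward [U]-orbits go to one end of the [T]-orbits, the same
    one almost everywhere by ergodicity; replacing [U] by its inverse, it is the
    positive end, and [U] interleaves with [T]. *)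
Theorem integrable_same_orbits_flip (T U : aut mu) : ergodic T ->
  aperiodic T -> aperiodic U -> L1_full_group T U -> full_group U T ->
  exists S : aut mu, T = (S * U * S^-1)%g \/ T = (S * U^-1 * S^-1)%g.
Proof.
move=> ergT apT apU LU UT.
have [mc cU Lc] := L1_cocycle QS apT LU.
have TU : {ae mu, forall x, exists n, U x = mp_pow T n x}.
  by apply: filterS cU => x ->; eexists.
have UT' : {ae mu, forall x, exists n, T x = mp_pow U n x}.
  by move: UT; apply: filterS => x [n ->]; exists n; rewrite aut_iterE.
have so : {ae mu, forall x, same_orbit T U x}.
  by apply: filterS3 (filterI apT apU) (ae_orbit_sub TU) (ae_orbit_sub UT') => x [].
have good : {ae mu, forall x, same_orbit T U x /\
    (forward T U x \/ forward T (mp_opp U) x)}.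
  apply: filterS3 so (ae_orbit T cU) (cocycle_sublinear T mc Lc) => x sox cx Mx.
  by split => //; exact: forward_or_backward sox cx Mx.
have [X0 [mX0 aeX0 X0T X0P]] := invariant_core T good.
have conj (u : mp_bij mu) (V : aut mu) : {ae mu, forall x, V x = u x} ->
    {ae mu, forall x, same_orbit T u x /\ forward T u x} ->
    exists S : aut mu, T = (S * V * S^-1)%g.
  move=> Vu /(interleaved_conjugate QS)[s sE]; exists (aut_of s).
  suff -> : (aut_of s * V = T * aut_of s)%g by rewrite mulgK.
  have aE := aut_ofE s; apply/aut_eqP.
  apply: filterS3 (filterI (aut_mul_ae (aut_of s) V) (aut_mul_ae T (aut_of s)))
    (filterI aE (ae_mp_comp V aE)) (filterI Vu sE) => x.
  by move=> [-> ->] [-> ->] [-> ->].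
have mA : measurable (X0 `&` [set x | drifts_up T U x]).
  by apply: measurableI => //; exact: measurable_drifts_up.
have [x n [Xx dx]|A0|A1] := ergT _ mA.
- rewrite aut_iterE; split; first exact: X0T.
  exact: drifts_up_orbit (X0P x Xx).1 dx.
- have [|S SE] := conj (mp_opp U) (U^-1)%g (aut_inv_ae U); last by exists S; right.
  have := A0 => /(ae_measure0 mu mA) nA; apply: filterS2 aeX0 nA => x Xx nA.
  have [sox [fw|bw]] := X0P x Xx.
    by case: nA; split => //; exact: forward_drifts_up.
  by split => //; exact: same_orbit_opp.
- have UU : {ae mu, forall x, U x = U x} by exact: aeW.
  have [|S SE] := conj U U UU; last by exists S; left.
  have : mu (~` (X0 `&` [set x | drifts_up T U x])) = 0%E.
    by rewrite probability_setC// A1 subee.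
  move=> /(ae_measure0 mu (measurableC mA)) nA; apply: filterS nA => x /contrapT[Xx dx].
  have [sox fb] := X0P x Xx; split => //; exact: drifts_up_forward fb dx.
Qed.

End belinskaya.

(** * Flip conjugacy and isomorphism *)

Section conjugation.
Context (R : realType) d (X : measurableType d) (mu : probability X R).
Implicit Types (S T U V : aut mu).

Lemma conj_point_ae S U : {ae mu, forall x, aut_repr (S * U * S^-1)%g (S x) = S (U x)}.
Proof.
by apply: filterS (ae_mp_comp S (conj_ae U S)) => x /= ->; rewrite mp_funK.
Qed.

Lemma conj_pow_ae S U : {ae mu, forall x, forall n,
  mp_pow (S * U * S^-1 : aut mu)%g n (S x) = S (mp_pow U n x)}.
Proof.
have H : {ae mu, forall x, S (U x) = aut_repr (S * U * S^-1)%g (S x)}.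
  by apply: filterS (conj_point_ae S U) => x ->.
by apply: filterS (ae_mp_pow_conj H) => x Hx n; rewrite Hx.
Qed.

Lemma ae_mp_uncomp S (P : X -> Prop) :
  {ae mu, forall x, P (S x)} -> {ae mu, forall x, P x}.
Proof.
by move=> /(ae_mp_comp (mp_opp S)); apply: filterS => x /=; rewrite mp_invK.
Qed.

(** The sign [e] treats conjugacy to [T] ([e = 1]) and to its inverse
    ([e = -1]) at once. *)
Definition carries (e : int) S T T' := e * e = 1 /\
  {ae mu, forall x, forall n, S (mp_pow T n x) = mp_pow T' (e * n) (S x)}.

Lemma flip_conjugate_carries T T' : flip_conjugate T T' ->
  exists e S, carries e S T T'.
Proof.
case=> S [->|->].
  exists 1, S; split => //; apply: filterS (conj_pow_ae S T) => x Sx n.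
  by rewrite mul1r Sx.
exists (-1), S; split => //.
apply: filterS2 (conj_pow_ae S (T^-1)%g)
  (ae_mp_pow (u := mp_opp T) (aut_inv_ae T)) => x Sx Tx n.
by rewrite mulN1r Sx Tx mp_powV opprK.
Qed.

Lemma carriesV e S T T' : carries e S T T' -> carries e (S^-1)%g T' T.
Proof.
move=> [ee ST]; split => //.
apply: filterS2 (ae_orbit T' (aut_inv_ae S)) (ae_mp_comp (mp_opp S) ST) => x Sx STx n.
rewrite Sx; have := Sx 0; rewrite mp_pow0 => ->.
apply: (can_inj (mp_funK S)); rewrite mp_invK STx /= mp_invK.
by rewrite mulrA ee mul1r.
Qed.

(** Multiplication by [e] maps the set of the exponents [n] with [U x = T^n x] onto
    the corresponding set for the conjugates at [S x]; the default value [0] is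
    compatible with it. *)
Lemma carries_cocycle e S T T' U : carries e S T T' ->
  {ae mu, forall x, cocycle T' (S * U * S^-1 : aut mu)%g (S x) = e * cocycle T U x}.
Proof.
move=> [ee ST]; apply: filterS2 ST (conj_point_ae S U) => x Sx SUx.
have eqE m : (aut_repr (S * U * S^-1)%g (S x) = mp_pow T' m (S x)) <->
    U x = mp_pow T (e * m) x.
  rewrite SUx; have := Sx (e * m); rewrite mulrA ee mul1r => <-.
  by split=> [/(can_inj (mp_funK S))|->].
have eK m : e * (e * m) = m by rewrite mulrA ee mul1r.
apply/cocycleE; have /cocycleE[good|[c0 bad]] := erefl (cocycle T U x).
  by left => m /=; rewrite eqE good; split=> [<-|->]; rewrite eK.
right; rewrite c0 mulr0; split => // m good; apply: (bad (e * m)) => k /=.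
by have := good (e * k); rewrite eqE eK => ->; split=> [<-|->]; rewrite eK.
Qed.

Variables (Q : nat -> nat -> set X) (QS : ball_scheme Q).

Lemma int_norm1_ae_eq (c c' : X -> int) : levels_measurable c -> levels_measurable c' ->
  {ae mu, forall x, `|c x| = `|c' x|} -> int_norm1 mu c = int_norm1 mu c'.
Proof.
move=> mc mc' cc'; apply/eqP; rewrite eq_le !int_norm1_le//.
  by apply: filterS cc' => x ->.
by apply: filterS cc' => x ->.
Qed.

Lemma carries_L1_full_group e S T T' U : carries e S T T' ->
  L1_full_group T U -> L1_full_group T' (S * U * S^-1)%g.
Proof.
move=> cS [TU LU]; have cSU := carries_cocycle U cS; have [ee ST] := cS.
have mc T0 U0 : levels_measurable (cocycle T0 U0) by exact: (measurable_cocycle QS).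
split.
  apply: (ae_mp_uncomp (S := S)).
  apply: filterS3 ST TU (conj_point_ae S U) => x Sx [n]; rewrite aut_iterE => Un ->.
  by exists (e * n); rewrite aut_iterE -Sx Un.
rewrite -/(int_norm1 mu _) -(int_norm1_mp S)//.
rewrite (@int_norm1_ae_eq _ (cocycle T U))//; first exact: (levels_measurable_mp S (mc _ _)).
have e1 : `|e| = 1 by nia.
by apply: filterS cSU => x ->; rewrite normrM e1 mul1r.
Qed.

Lemma carries_dist e S T T' U V : carries e S T T' ->
  L1_dist T' (S * U * S^-1)%g (S * V * S^-1)%g = L1_dist T U V.
Proof.
move=> cS; have ee := cS.1.
have mc T0 U0 : levels_measurable (cocycle T0 U0) by exact: (measurable_cocycle QS).
have mcB T0 U0 V0 : levels_measurable (fun x => cocycle T0 U0 x - cocycle T0 V0 x).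
  exact: (measurable_levels_comp (fun i : int * int => i.1 - i.2)
    (measurable_levels_pair (mc T0 U0) (mc T0 V0))).
rewrite /L1_dist -!/(int_norm1 mu (fun x => _)).
rewrite -[LHS](int_norm1_mp S)//.
apply: int_norm1_ae_eq => //.
  exact: (levels_measurable_mp S (mcB _ _ _)).
apply: filterS2 (carries_cocycle U cS) (carries_cocycle V cS) => x -> ->.
have e1 : `|e| = 1 by nia.
by rewrite -mulrBr normrM e1 mul1r.
Qed.

Lemma conj_isomorphism e S T T' : carries e S T T' ->
  group_isomorphism (L1_full_group T) (L1_full_group T') (fun U => S * U * S^-1)%g.
Proof.
move=> cS; split; first split.
- by move=> U; exact: carries_L1_full_group cS.
- move=> U V _ _ /(congr1 (fun W => S^-1 * W * S)%g).
  by rewrite !mulgA !mulVg !mul1g -!mulgA !mulVg !mulg1.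
- move=> V LV; exists (S^-1 * V * S)%g.
    by have := carries_L1_full_group (carriesV cS) LV; rewrite invgK.
  by rewrite !mulgA mulgV mul1g -mulgA mulgV mulg1.
- by move=> U V _ _; rewrite !mulgA -[(S * U * S^-1 * S)%g]mulgA mulVg mulg1.
Qed.

Lemma carries_L1_isomorphic e S T T' : carries e S T T' -> L1_isomorphic T T'.
Proof. by move=> cS; eexists; exact: conj_isomorphism cS. Qed.

Lemma carries_L1_topologically_isomorphic e S T T' : carries e S T T' ->
  L1_topologically_isomorphic T T'.
Proof.
move=> cS; have cV := carriesV cS.
exists (fun U => S * U * S^-1)%g, (fun U => S^-1 * U * S^-1^-1)%g; split.
- exact: conj_isomorphism cS.
- exact: conj_isomorphism cV.
- by move=> U _; rewrite invgK !mulgA mulVg mul1g -mulgA mulVg mulg1.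
- by move=> U _ r r0; exists r => // V _; rewrite (carries_dist _ _ cS).
- by move=> U _ r r0; exists r => // V _; rewrite (carries_dist _ _ cV).
Qed.

(** The isomorphism is the conjugation by some [S]; then [S T S^-1] lies in the
    integrable full group of [T'] and has the same orbits as [T']. *)
Lemma L1_isomorphic_flip_conjugate T T' : aperiodic T -> aperiodic T' ->
  ergodic T -> ergodic T' -> L1_isomorphic T T' -> flip_conjugate T T'.
Proof.
move=> apT apT' ergT ergT' [phi iso].
have LT := L1_full_groupT QS apT.
have GT := L1_many_involutions QS apT; have GT' := L1_many_involutions QS apT'.
have [S SE] := reconstruction QS GT GT' iso LT ergT.
pose U : aut mu := (S * T * S^-1)%g.
have LU : L1_full_group T' U by rewrite /U -SE//; exact: iso_in iso _ LT.
have apU : aperiodic U.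
  apply: (ae_mp_uncomp (S := S)); apply: filterS2 apT (conj_pow_ae S T) => x Tx Sx n.
  by rewrite Sx => /(can_inj (mp_funK S))/Tx.
have UT' : full_group U T'.
  have [V LV VE] := iso_surj iso (L1_full_groupT QS apT').
  apply: (ae_mp_uncomp (S := S)); have [TV _] := LV.
  rewrite -VE SE//.
  apply: filterS3 TV (conj_pow_ae S T) (conj_point_ae S V) => x [n Vn] Sx ->.
  by exists n; rewrite aut_iterE Sx Vn aut_iterE.
have [S' S'E] := integrable_same_orbits_flip QS ergT' apT' apU LU UT'.
exists (S' * S)%g; case: S'E => ->; [left|right]; rewrite /U.
  by rewrite invgM !mulgA.
by rewrite !invgM invgK !mulgA.
Qed.

End conjugation.

Theorem theorem1p2 (R : realType) (d : measure_display) (X : measurableType d)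
    (mu : probability X R) (T T' : aut mu) :
  standard_probability_space mu -> ergodic T -> ergodic T' ->
  [<-> flip_conjugate T T';
       L1_isomorphic T T';
       L1_topologically_isomorphic T T'].
Proof.
move=> [/standard_borel_scheme[Q QS] na] ergT ergT'.
have apT := ergodic_aperiodic QS na ergT; have apT' := ergodic_aperiodic QS na ergT'.
have iso_flip := L1_isomorphic_flip_conjugate QS apT apT' ergT ergT'.
tfae.
- by move=> /flip_conjugate_carries[e [S cS]]; exact: (carries_L1_isomorphic QS cS).
- move=> /iso_flip/flip_conjugate_carries[e [S cS]].
  exact: (carries_L1_topologically_isomorphic QS cS).
- by case=> phi [psi [iso _ _ _ _]]; apply: iso_flip; exists phi.
Qed.
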